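(* Let $n$ be a natural number and let $N, A$ be finite-dimensional unital associative $\mathbb C$-algebras of dimension $n$. The following statements are equivalent: \begin{itemize} \item There is a flat deformation from $N$ to $A$. \item There exist a natural number $\rho$ and a unital $\mathbb C\{t\}$-algebra homomorphism $f:\mathbb C\langle x_1,\ldots,x_\rho\rangle\{t\}\to A((t))$ such that (1) $f(x_i)\in A[t,t^{-1}]$ for every $i$; (2) there are $c_1,\ldots,c_n\in\mathbb C\langle x_1,\ldots,x_\rho\rangle$ such that $f(c_1),\ldots,f(c_n)$ are linearly independent over $\mathbb C\{t\}$; (3) there is a natural number $\gamma$ with $\operatorname{Im}(f)\subseteq t^{-\gamma}A\{t\}$; and such that $\operatorname{Im}(f)/t\cdot\operatorname{Im}(f)$ is isomorphic to $N$ as a unital $\mathbb C$-algebra. \end{itemize}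
   Context: All algebras are associative and unital (usually noncommutative) and all algebra homomorphisms are unital. $\mathbb C\{t\}$ denotes the ring of formal power series in $t$ over $\mathbb C$ (no convergence assumed). $\mathbb C\langle x_1,\ldots,x_\rho\rangle\{t\}$ denotes the free unital associative $\mathbb C\{t\}$-algebra on $x_1,\ldots,x_\rho$ (finite $\mathbb C\{t\}$-linear combinations of words); it contains the free $\mathbb C$-algebra $\mathbb C\langle x_1,\ldots,x_\rho\rangle$. For a finite-dimensional $\mathbb C$-algebra $A$, $A\{t\}$, $A((t))$ and $A[t,t^{-1}]$ denote respectively the power series, Laurent series and Laurent polynomials in the central variable $t$ with coefficients in $A$. A deformation of a unital $\mathbb C$-algebra $N$ over $\mathbb C\{t\}$ is a $\mathbb C\{t\}$-algebra $\mathcal N$ which is a free $\mathbb C\{t\}$-module and such that $\mathcal N/t\mathcal N$ is isomorphic to $N$; it is assumed that the image of the identity element of $N$ is the identity element of $\mathcal N$. A flat deformation from $N$ to a unital algebra $A$ (over $\mathbb C\{t\}$) is such a deformation $\mathcal N$ for which $\mathcal N\otimes_{\mathbb C\{t\}}\mathbb C\{\{t\}\}$ is isomorphic to $A\otimes_{\mathbb C}\mathbb C\{\{t\}\}$, where $\mathbb C\{\{t\}\}$ denotes the algebraic closure of the fraction field of $\mathbb C\{t\}$. *)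

(* Defs.v *)
From HB Require Import structures.
From mathcomp Require Import all_boot all_order all_algebra.
From mathcomp Require Import generic_quotient fraction.
From mathcomp Require Import finmap monalg.
From mathcomp Require Import boolp reals complex.

Set Implicit Arguments.
Unset Strict Implicit.
Unset Printing Implicit Defensive.

Import Order.TTheory GRing.Theory Num.Theory.

Local Open Scope quotient_scope.
Local Open Scope ring_scope.

(* [algType R] requires [1 != 0].  This is too strong here: the algebra of
   dimension [0] is allowed, and [B / t B] or [B (x) K] may vanish even when
   [B] does not.  The product has to be part of the mixin, because a structure
   joining [pzRingType] and [lmodType R] would have to be declared before
   [algType R]; the ring structure of [A : pzAlgType R] is recovered below. *)

HB.mixin Record Lmodule_isPzAlgebra (R : pzRingType) A of GRing.Lmodule R A := {
  amul : A -> A -> A;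
  aone : A;
  amulA : associative amul;
  amul1l : left_id aone amul;
  amul1r : right_id aone amul;
  amulDl : left_distributive amul +%R;
  amulDr : right_distributive amul +%R;
  ascalerAl : forall (a : R) (u v : A), a *: amul u v = amul (a *: u) v;
  ascalerAr : forall (a : R) (u v : A), a *: amul u v = amul u (a *: v)
}.

#[short(type="pzAlgType")]
HB.structure Definition PzAlgebra (R : pzRingType) :=
  {A of Lmodule_isPzAlgebra R A & GRing.Lmodule R A}.

HB.instance Definition _ (R : pzRingType) (A : pzAlgType R) :=
  GRing.Zmodule_isPzRing.Build (PzAlgebra.sort A)
    (@amulA R A) (@amul1l R A) (@amul1r R A) (@amulDl R A) (@amulDr R A).

Coercion pzalg_pzRing (R : pzRingType) (A : pzAlgType R) : pzRingType :=
  PzAlgebra.sort A.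

HB.factory Record PzRing_Lmodule_isPzAlgebra (R : pzRingType) A
    of GRing.PzRing A & GRing.Lmodule R A := {
  scalerAl : forall (a : R) (u v : A), a *: (u * v) = (a *: u) * v;
  scalerAr : forall (a : R) (u v : A), a *: (u * v) = u * (a *: v)
}.
HB.builders Context R A of PzRing_Lmodule_isPzAlgebra R A.
HB.instance Definition _ := Lmodule_isPzAlgebra.Build R A
  (@mulrA A) (@mul1r A) (@mulr1 A) (@mulrDl A) (@mulrDr A) scalerAl scalerAr.
HB.end.

Lemma pzscalerAl (R : pzRingType) (A : pzAlgType R) (a : R) (u v : A) :
  a *: (u * v) = (a *: u) * v.
Proof. exact: ascalerAl. Qed.

Lemma pzscalerAr (R : pzRingType) (A : pzAlgType R) (a : R) (u v : A) :
  a *: (u * v) = u * (a *: v).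
Proof. exact: ascalerAr. Qed.

HB.instance Definition _ (R : pzRingType) (A : algType R) :=
  PzRing_Lmodule_isPzAlgebra.Build R (GRing.Algebra.sort A)
    (@GRing.scalerAl R A) (@GRing.scalerAr R A).

(* [{lrmorphism U -> V}] is not available, as it needs [1 != 0] in [U]. *)
Definition alg_isomorphic (R : pzRingType) (U V : pzAlgType R) : Prop :=
  exists f : {rmorphism U -> V}, scalable f /\ bijective f.

(* Finite families are taken along duplicate-free lists, so that [I] may be
   infinite. *)
Section Bases.
Variables (R : pzRingType) (M : lmodType R) (I : eqType) (b : I -> M).

Definition lin_indep : Prop :=
  forall (s : seq I) (a : I -> R), uniq s ->
    \sum_(i <- s) a i *: b i = 0 -> {in s, forall i, a i = 0}.

Definition spanning : Prop :=
  forall x : M, exists (s : seq I) (a : I -> R), x = \sum_(i <- s) a i *: b i.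

Definition is_basis : Prop := lin_indep /\ spanning.

End Bases.

Definition free_module (R : pzRingType) (M : lmodType R) : Prop :=
  exists (I : eqType) (b : I -> M), is_basis b.

Definition has_dim (F : fieldType) (V : lmodType F) (n : nat) : Prop :=
  exists b : 'I_n -> V, is_basis b.

(* A{t} *)
Record fps (A : Type) := Fps { fps_coef : nat -> A }.

HB.instance Definition _ (A : Type) := gen_eqMixin (fps A).
HB.instance Definition _ (A : Type) := gen_choiceMixin (fps A).

Lemma fpsP (A : Type) (p q : fps A) :
  (forall i, fps_coef p i = fps_coef q i) -> p = q.
Proof. by case: p q => [p] [q] /= /funext ->. Qed.

Section FpsZmodule.
Variable A : zmodType.
Implicit Types p q : fps A.

Definition fps_zero : fps A := Fps (fun=> 0).
Definition fps_opp p := Fps (fun i => - fps_coef p i).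
Definition fps_add p q := Fps (fun i => fps_coef p i + fps_coef q i).

Fact fps_addA : associative fps_add.
Proof. by move=> p q r; apply: fpsP => i /=; rewrite addrA. Qed.
Fact fps_addC : commutative fps_add.
Proof. by move=> p q; apply: fpsP => i /=; rewrite addrC. Qed.
Fact fps_add0 : left_id fps_zero fps_add.
Proof. by move=> p; apply: fpsP => i /=; rewrite add0r. Qed.
Fact fps_addN : left_inverse fps_zero fps_opp fps_add.
Proof. by move=> p; apply: fpsP => i /=; rewrite addNr. Qed.

HB.instance Definition _ :=
  GRing.isZmodule.Build (fps A) fps_addA fps_addC fps_add0 fps_addN.

Lemma fps_coefD p q i : fps_coef (p + q) i = fps_coef p i + fps_coef q i.
Proof. by []. Qed.
Lemma fps_coefN p i : fps_coef (- p) i = - fps_coef p i.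
Proof. by []. Qed.
Lemma fps_coef0 i : fps_coef (0 : fps A) i = 0.
Proof. by []. Qed.

End FpsZmodule.

Section FpsPzRing.
Variable A : pzRingType.
Implicit Types p q r : fps A.

Definition fps_const (a : A) : fps A := Fps (fun i => if i == 0%N then a else 0).

Definition fps_mul p q : fps A :=
  Fps (fun k => \sum_(i < k.+1) fps_coef p i * fps_coef q (k - i)).

Lemma fps_mul_rev p q k :
  fps_coef (fps_mul p q) k = \sum_(i < k.+1) fps_coef p (k - i) * fps_coef q i.
Proof.
rewrite /= (reindex_inj rev_ord_inj) /=; apply: eq_bigr => j _.
by rewrite subSS (subKn (leq_ord j)).
Qed.

Fact fps_mulA : associative fps_mul.
Proof.
move=> p q r; apply: fpsP => i; rewrite [RHS]fps_mul_rev.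
pose coef3 j k := fps_coef p j * (fps_coef q (i - j - k)%N * fps_coef r k).
transitivity (\sum_(j < i.+1) \sum_(k < i.+1 | (k <= i - j)%N) coef3 j k).
  apply: eq_bigr => j _; rewrite fps_mul_rev big_distrr /=.
  by rewrite (big_ord_narrow_leq (leq_subr _ _)).
rewrite (exchange_big_dep predT) //=; apply: eq_bigr => k _.
transitivity (\sum_(j < i.+1 | (j <= i - k)%N) coef3 j k).
  apply: eq_bigl => j; rewrite -ltnS -(ltnS j) -!subSn ?leq_ord //.
  by rewrite -subn_gt0 -(subn_gt0 j) -!subnDA addnC.
rewrite (big_ord_narrow_leq (leq_subr _ _)) big_distrl /=.
by apply: eq_bigr => j _; rewrite /coef3 -!subnDA addnC mulrA.
Qed.

Fact fps_mul1p : left_id (fps_const 1) fps_mul.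
Proof.
move=> p; apply: fpsP => i /=; rewrite big_ord_recl subn0 /= mul1r.
by rewrite big1 ?addr0 // => j _; rewrite mul0r.
Qed.
Fact fps_mulp1 : right_id (fps_const 1) fps_mul.
Proof.
move=> p; apply: fpsP => i; rewrite fps_mul_rev big_ord_recl subn0 /= mulr1.
by rewrite big1 ?addr0 // => j _; rewrite mulr0.
Qed.
Fact fps_mulDl : left_distributive fps_mul +%R.
Proof.
move=> p q r; apply: fpsP => i /=; rewrite -big_split /=.
by apply: eq_bigr => j _; rewrite mulrDl.
Qed.
Fact fps_mulDr : right_distributive fps_mul +%R.
Proof.
move=> p q r; apply: fpsP => i /=; rewrite -big_split /=.
by apply: eq_bigr => j _; rewrite mulrDr.
Qed.

HB.instance Definition _ := GRing.Zmodule_isPzRing.Build (fps A)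
  fps_mulA fps_mul1p fps_mulp1 fps_mulDl fps_mulDr.

Lemma fps_coefM p q k :
  fps_coef (p * q) k = \sum_(i < k.+1) fps_coef p i * fps_coef q (k - i).
Proof. by []. Qed.
Lemma fps_coefMr p q k :
  fps_coef (p * q) k = \sum_(i < k.+1) fps_coef p (k - i) * fps_coef q i.
Proof. exact: fps_mul_rev. Qed.
Lemma fps_coefC a i : fps_coef (fps_const a) i = if i == 0%N then a else 0.
Proof. by []. Qed.
Lemma fps_coef1 i : fps_coef (1 : fps A) i = (i == 0%N)%:R.
Proof. by case: i. Qed.

Lemma fps_constD a b : fps_const (a - b) = fps_const a - fps_const b.
Proof. by apply: fpsP => -[|i] //=; rewrite subr0. Qed.
Lemma fps_constM a b : fps_const (a * b) = fps_const a * fps_const b.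
Proof.
apply: fpsP => i; rewrite fps_coefM big_ord_recl big1 ?addr0 /= => [|j _].
  by rewrite subn0; case: ifP; rewrite ?mulr0.
by rewrite mul0r.
Qed.
HB.instance Definition _ := GRing.isZmodMorphism.Build A (fps A)
  fps_const fps_constD.
HB.instance Definition _ := GRing.isMonoidMorphism.Build A (fps A)
  fps_const (erefl, fps_constM).

Definition fps_t : fps A := Fps (fun i => (i == 1%N)%:R).

Definition fps_behead p : fps A := Fps (fun i => fps_coef p i.+1).

Lemma fps_beheadMl p q : fps_coef p 0 = 0 ->
  fps_coef (p * q) 0 = 0 /\ fps_behead (p * q) = fps_behead p * q.
Proof.
move=> p0; split; first by rewrite fps_coefM big_ord1 /= p0 mul0r.
apply: fpsP => i; rewrite [LHS]fps_coefM big_ord_recl p0 mul0r add0r.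
by apply: eq_bigr => j _; rewrite subSS.
Qed.

Lemma fps_beheadMr p q : fps_coef q 0 = 0 ->
  fps_coef (p * q) 0 = 0 /\ fps_behead (p * q) = p * fps_behead q.
Proof.
move=> q0; split; first by rewrite fps_coefM big_ord1 /= q0 mulr0.
apply: fpsP => i; rewrite [LHS]fps_coefMr big_ord_recl q0 mulr0 add0r fps_coefMr.
by apply: eq_bigr => j _; rewrite subSS.
Qed.

End FpsPzRing.

Arguments fps_const {A}.
Arguments fps_t {A}.

Section FpsComRing.
Variable A : comNzRingType.
Implicit Types p q : fps A.

Fact fps_mulC : commutative (@GRing.mul (fps A)).
Proof.
move=> p q; apply: fpsP => i; rewrite fps_coefM fps_coefMr.
by apply: eq_bigr => j _; rewrite mulrC.
Qed.
HB.instance Definition _ := GRing.PzRing_hasCommutativeMul.Build (fps A) fps_mulC.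

Fact fps_1neq0 : (1 : fps A) != 0.
Proof.
apply/eqP => /(congr1 (fun p => fps_coef p 0)) /eqP.
by rewrite fps_coef1 /= oner_eq0.
Qed.
HB.instance Definition _ := GRing.PzSemiRing_isNonZero.Build (fps A) fps_1neq0.

Definition fps_unit : {pred fps A} := fun p => `[< exists q, q * p = 1 >].
Definition fps_inv p : fps A :=
  if pselect (exists q, q * p = 1) is left h then projT1 (cid h) else p.

Fact fps_mulVp : {in fps_unit, left_inverse 1 fps_inv *%R}.
Proof.
move=> p /asboolP pU; rewrite /fps_inv; case: pselect => // h.
by case: cid.
Qed.
Fact fps_unitPl p q : q * p = 1 -> fps_unit p.
Proof. by move=> pq; apply/asboolP; exists q. Qed.
Fact fps_inv_out : {in [predC fps_unit], fps_inv =1 id}.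
Proof.
by move=> p; rewrite inE /= => /asboolP pU; rewrite /fps_inv; case: pselect.
Qed.
HB.instance Definition _ := GRing.ComNzRing_hasMulInverse.Build (fps A)
  fps_mulVp fps_unitPl fps_inv_out.

End FpsComRing.

Section FpsIdomain.
Variable A : idomainType.

Lemma fps_order (p : fps A) : p != 0 ->
  exists2 m, fps_coef p m != 0 & forall i, (i < m)%N -> fps_coef p i = 0.
Proof.
move=> p0; have ex : exists i, fps_coef p i != 0.
  apply: contrapT => /forallNP h; move/eqP: p0; apply; apply: fpsP => i.
  by apply: contrapT => /eqP /h.
exists (ex_minn ex); case: ex_minnP => // m _ mn i im.
by apply/eqP; apply: contraLR im; rewrite -leqNgt => /mn.
Qed.

Fact fps_integral : GRing.integral_domain_axiom (fps A).
Proof.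
move=> p q pq; apply/negPn; rewrite negb_or; apply/negP.
case/andP=> /fps_order[m pm pl] /fps_order[n qn ql].
have /eqP := congr1 (fun r => fps_coef r (m + n)) pq; apply/negP.
have mn : (m < (m + n).+1)%N by rewrite ltnS leq_addr.
rewrite fps_coefM fps_coef0 (bigD1 (Ordinal mn)) //= big1 ?addr0 => [|i im].
  by rewrite addKn mulf_eq0 negb_or pm.
have [lt|gt] := ltnP i m; first by rewrite pl ?mul0r.
rewrite ql ?mulr0 // ltn_subLR; last by rewrite -ltnS.
rewrite ltn_add2r ltn_neqAle gt andbT eq_sym.
by apply: contraNneq im => e; apply/eqP/val_inj.
Qed.
HB.instance Definition _ :=
  GRing.ComUnitRing_isIntegral.Build (fps A) fps_integral.

End FpsIdomain.

(* A((t)) *)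
Record laurent (A : zmodType) := Laurent {
  lau_coef : int -> A;
  lau_bounded : exists m : nat, forall i : int, i < - m%:Z -> lau_coef i = 0
}.

HB.instance Definition _ (A : zmodType) := gen_eqMixin (laurent A).
HB.instance Definition _ (A : zmodType) := gen_choiceMixin (laurent A).

Lemma lauP (A : zmodType) (f g : laurent A) :
  (forall i, lau_coef f i = lau_coef g i) -> f = g.
Proof.
case: f g => [f fb] [g gb] /= /funext e.
by rewrite e in fb *; congr Laurent; apply: Prop_irrelevance.
Qed.

Section LaurentZmodule.
Variable A : zmodType.
Implicit Types f g : laurent A.

Fact lau_zero_bounded :
  exists m : nat, forall i : int, i < - m%:Z -> (0 : A) = 0.
Proof. by exists 0%N. Qed.
Definition lau_zero : laurent A := Laurent (lau_coef := fun=> 0) lau_zero_bounded.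

Fact lau_opp_bounded f :
  exists m : nat, forall i : int, i < - m%:Z -> - lau_coef f i = 0.
Proof. by case: f => f [m fm]; exists m => i /fm /= ->; rewrite oppr0. Qed.
Definition lau_opp f : laurent A := Laurent (lau_opp_bounded f).

Lemma lau_bound_le f (m n : nat) : (m <= n)%N ->
  (forall i : int, i < - m%:Z -> lau_coef f i = 0) ->
  forall i : int, i < - n%:Z -> lau_coef f i = 0.
Proof.
by move=> mn fm i im; apply/fm/(lt_le_trans im);
  rewrite lerN2 lez_nat.
Qed.

Fact lau_add_bounded f g : exists m : nat,
  forall i : int, i < - m%:Z -> lau_coef f i + lau_coef g i = 0.
Proof.
have [[m fm] [n gn]] := (lau_bounded f, lau_bounded g).
exists (maxn m n) => i ib.
rewrite (lau_bound_le (leq_maxl m n) fm ib).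
by rewrite (lau_bound_le (leq_maxr m n) gn ib) addr0.
Qed.
Definition lau_add f g : laurent A := Laurent (lau_add_bounded f g).

Fact lau_addA : associative lau_add.
Proof. by move=> p q r; apply: lauP => i /=; rewrite addrA. Qed.
Fact lau_addC : commutative lau_add.
Proof. by move=> p q; apply: lauP => i /=; rewrite addrC. Qed.
Fact lau_add0 : left_id lau_zero lau_add.
Proof. by move=> p; apply: lauP => i /=; rewrite add0r. Qed.
Fact lau_addN : left_inverse lau_zero lau_opp lau_add.
Proof. by move=> p; apply: lauP => i /=; rewrite addNr. Qed.

HB.instance Definition _ :=
  GRing.isZmodule.Build (laurent A) lau_addA lau_addC lau_add0 lau_addN.

Lemma lau_coefD f g i : lau_coef (f + g) i = lau_coef f i + lau_coef g i.
Proof. by []. Qed.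

(* [lau_shift m p] is t^(-m) p, and [lau_trunc m f] is t^m f, the latter
   provided that [f] lies in t^(-m) A{t}. *)
Fact lau_shift_bounded (m : nat) (p : fps A) : exists k : nat,
  forall i : int, i < - k%:Z ->
    (if i + m%:Z is Posz j then fps_coef p j else 0) = 0.
Proof.
exists m => i im; have : i + m%:Z < 0 by rewrite -ltrBrDr sub0r.
by case: (i + m%:Z).
Qed.
Definition lau_shift (m : nat) (p : fps A) : laurent A :=
  Laurent (lau_shift_bounded m p).

Definition lau_trunc (m : nat) f : fps A :=
  Fps (fun k => lau_coef f (k%:Z - m%:Z)).

Definition bounded_by (m : nat) f :=
  forall i : int, i < - m%:Z -> lau_coef f i = 0.

Definition lau_bound f : nat := projT1 (cid (lau_bounded f)).
Lemma lau_boundP f : bounded_by (lau_bound f) f.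
Proof. exact: projT2 (cid (lau_bounded f)). Qed.

Lemma lau_shiftK m : cancel (lau_shift m) (lau_trunc m).
Proof. by move=> p; apply: fpsP => i /=; rewrite subrK. Qed.

Lemma lau_truncK m f : bounded_by m f -> lau_shift m (lau_trunc m f) = f.
Proof.
move=> fm; apply: lauP => i /=; case E: (i + m%:Z) => [j|j].
  by rewrite /= -E addrK.
by rewrite fm // -[_ < _]subr_lt0 opprK E.
Qed.

Lemma lau_shift_boundedP m p : bounded_by m (lau_shift m p).
Proof.
move=> i im /=; have : i + m%:Z < 0 by rewrite -ltrBrDr sub0r.
by case: (i + m%:Z).
Qed.

End LaurentZmodule.

Section LaurentPzRing.
Variable A : pzRingType.
Implicit Types (f g h : laurent A) (p q : fps A).

Lemma lau_trunc_behead m f : bounded_by m f ->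
  fps_coef (lau_trunc m.+1 f) 0 = 0 /\
  fps_behead (lau_trunc m.+1 f) = lau_trunc m f.
Proof.
move=> fm; split; first by rewrite /= fm // sub0r ltrN2 ltz_nat.
by apply: fpsP => i /=; congr lau_coef; rewrite !intS opprD addrACA subrr add0r.
Qed.

Lemma lau_shift_behead m p : fps_coef p 0 = 0 ->
  lau_shift m.+1 p = lau_shift m (fps_behead p).
Proof.
move=> p0; apply: lauP => i /=; rewrite intS addrCA addrC.
by case: (i + m%:Z) => [j|[|j]] //=; rewrite ?addn1 //.
Qed.

Lemma bounded_by_le m n f : (m <= n)%N -> bounded_by m f -> bounded_by n f.
Proof. exact: lau_bound_le. Qed.

(* (t^(-m) p) (t^(-n) q) = t^(-m-n) (p q); independent of the bounds used, by
   [lau_mulE] below. *)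
Definition lau_mul f g : laurent A :=
  lau_shift (lau_bound f + lau_bound g)
    (lau_trunc (lau_bound f) f * lau_trunc (lau_bound g) g).

Lemma lau_mul_bound (m n k l : nat) f g : bounded_by m f -> bounded_by n g ->
  lau_shift (k + m + (l + n)) (lau_trunc (k + m) f * lau_trunc (l + n) g) =
  lau_shift (m + n) (lau_trunc m f * lau_trunc n g).
Proof.
move=> fm gn; elim: k => [|k IHk].
  elim: l => [//|l IHl]; rewrite -{}IHl !add0n addSn addnS.
  have gl : bounded_by (l + n) g by apply: bounded_by_le gn; rewrite leq_addl.
  have [g0 gb] := lau_trunc_behead gl.
  have [pg0 pgb] := fps_beheadMr (lau_trunc m f) g0.
  by rewrite lau_shift_behead // pgb gb.
rewrite -{}IHk !addSn.
have fk : bounded_by (k + m) f by apply: bounded_by_le fm; rewrite leq_addl.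
have [f0 fb] := lau_trunc_behead fk.
have [pf0 pfb] := fps_beheadMl (lau_trunc (l + n) g) f0.
by rewrite lau_shift_behead // pfb fb.
Qed.

Lemma lau_mulE (m n : nat) f g : bounded_by m f -> bounded_by n g ->
  lau_mul f g = lau_shift (m + n) (lau_trunc m f * lau_trunc n g).
Proof.
move=> fm gn; have fb := @lau_boundP _ f; have gb := @lau_boundP _ g.
rewrite /lau_mul -(lau_mul_bound m n fb gb).
rewrite -(lau_mul_bound (lau_bound f) (lau_bound g) fm gn).
by rewrite (addnC m) (addnC n).
Qed.

Lemma lau_mul_shift m n p q :
  lau_mul (lau_shift m p) (lau_shift n q) = lau_shift (m + n) (p * q).
Proof.
by rewrite (lau_mulE (lau_shift_boundedP p) (lau_shift_boundedP q)) !lau_shiftK.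
Qed.

Lemma lau_shiftD m p q : lau_shift m (p + q) = lau_shift m p + lau_shift m q.
Proof.
by apply: lauP => i; rewrite lau_coefD /=; case: (i + m%:Z); rewrite ?addr0.
Qed.

Lemma lauW f : exists m p, f = lau_shift m p.
Proof.
exists (lau_bound f), (lau_trunc (lau_bound f) f).
by rewrite lau_truncK //; apply: lau_boundP.
Qed.

Lemma lauW2 f g : exists m p q, f = lau_shift m p /\ g = lau_shift m q.
Proof.
pose m := maxn (lau_bound f) (lau_bound g).
exists m, (lau_trunc m f), (lau_trunc m g).
rewrite !lau_truncK //.
  by apply: bounded_by_le (@lau_boundP _ g); rewrite leq_maxr.
by apply: bounded_by_le (@lau_boundP _ f); rewrite leq_maxl.
Qed.

Fact lau_mulA : associative lau_mul.
Proof.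
move=> f g h; have [m [p ->]] := lauW f; have [n [q ->]] := lauW g.
by have [k [r ->]] := lauW h; rewrite !lau_mul_shift mulrA addnA.
Qed.
Fact lau_mul1 : left_id (lau_shift 0 1) lau_mul.
Proof.
by move=> f; have [m [p ->]] := lauW f; rewrite lau_mul_shift mul1r.
Qed.
Fact lau_mulr1 : right_id (lau_shift 0 1) lau_mul.
Proof.
by move=> f; have [m [p ->]] := lauW f; rewrite lau_mul_shift mulr1 addn0.
Qed.
Fact lau_mulDl : left_distributive lau_mul +%R.
Proof.
move=> f g h; have [m [p [q [-> ->]]]] := lauW2 f g; have [k [r ->]] := lauW h.
by rewrite -lau_shiftD !lau_mul_shift mulrDl lau_shiftD.
Qed.
Fact lau_mulDr : right_distributive lau_mul +%R.
Proof.
move=> h f g; have [m [p [q [-> ->]]]] := lauW2 f g; have [k [r ->]] := lauW h.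
by rewrite -lau_shiftD !lau_mul_shift mulrDr lau_shiftD.
Qed.

HB.instance Definition _ := GRing.Zmodule_isPzRing.Build (laurent A)
  lau_mulA lau_mul1 lau_mulr1 lau_mulDl lau_mulDr.

Lemma lau_shiftM m n p q :
  lau_shift m p * lau_shift n q = lau_shift (m + n) (p * q).
Proof. exact: lau_mul_shift. Qed.

End LaurentPzRing.

Section LaurentAlgebra.
Variables (F : comNzRingType) (A : pzAlgType F).
Implicit Types (c d : fps F) (p q : fps A) (f g : laurent A).

(* The central series sum_i (c_i 1_A) t^i. *)
Definition fps_in_alg c : fps A := Fps (fun i => fps_coef c i *: (1 : A)).

Lemma fps_in_algD c d : fps_in_alg (c + d) = fps_in_alg c + fps_in_alg d.
Proof. by apply: fpsP => i /=; rewrite scalerDl. Qed.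
Lemma fps_in_alg1 : fps_in_alg 1 = 1.
Proof. by apply: fpsP => -[|i] /=; rewrite ?scale1r ?scale0r. Qed.
Lemma fps_in_algM c d : fps_in_alg (c * d) = fps_in_alg c * fps_in_alg d.
Proof.
apply: fpsP => i /=; rewrite scaler_suml; apply: eq_bigr => j _.
by rewrite -pzscalerAl mul1r scalerA.
Qed.
Lemma fps_in_algC c p : fps_in_alg c * p = p * fps_in_alg c.
Proof.
apply: fpsP => i; rewrite fps_coefM fps_coefMr; apply: eq_bigr => j _ /=.
by rewrite -pzscalerAl -pzscalerAr mul1r mulr1.
Qed.

Definition lau_scale c f : laurent A := lau_shift 0 (fps_in_alg c) * f.

Fact lau_scaleA c d f : lau_scale c (lau_scale d f) = lau_scale (c * d) f.
Proof. by rewrite /lau_scale mulrA lau_shiftM fps_in_algM. Qed.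
Fact lau_scale1 : left_id 1 lau_scale.
Proof. by move=> f; rewrite /lau_scale fps_in_alg1 mul1r. Qed.
Fact lau_scaleDr : right_distributive lau_scale +%R.
Proof. by move=> c f g; rewrite /lau_scale mulrDr. Qed.
Fact lau_scaleDl f : {morph lau_scale^~ f : c d / c + d}.
Proof. by move=> c d; rewrite /lau_scale fps_in_algD lau_shiftD mulrDl. Qed.

HB.instance Definition _ := GRing.Zmodule_isLmodule.Build (fps F) (laurent A)
  lau_scaleA lau_scale1 lau_scaleDr lau_scaleDl.

Fact lau_scaleAl c f g : c *: (f * g) = (c *: f) * g.
Proof. exact: mulrA. Qed.
Fact lau_scaleAr c f g : c *: (f * g) = f * (c *: g).
Proof.
rewrite mulrA /GRing.scale /= /lau_scale mulrA; congr (_ * _).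
have [m [p ->]] := lauW f.
by rewrite !lau_shiftM fps_in_algC addn0.
Qed.

HB.instance Definition _ :=
  PzRing_Lmodule_isPzAlgebra.Build (fps F) (laurent A) lau_scaleAl lau_scaleAr.

End LaurentAlgebra.

(* The lower bound is part of the definition of [laurent A]. *)
Definition laurent_polynomial (A : zmodType) (f : laurent A) : Prop :=
  exists m : nat, forall i : int, m%:Z < i -> lau_coef f i = 0.

(* R<x_1, ..., x_rho>: finite R-linear combinations of words *)
Definition free_alg (R : comNzRingType) (rho : nat) : Type :=
  {malg R[{fmonom 'I_rho}]}.
HB.instance Definition _ (R : comNzRingType) (rho : nat) :=
  GRing.Lalgebra.on (free_alg R rho).

Definition free_var (R : comNzRingType) (rho : nat) (i : 'I_rho) :
  free_alg R rho := << fmu i >>.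

(* The inclusion of R<x_1, ..., x_rho> in the free algebra over R{t}. *)
Definition free_const (R : comNzRingType) (rho : nat) (c : free_alg R rho) :
    free_alg (fps R) rho :=
  \sum_(w <- msupp c) << fps_const c@_w *g w >>.

Section Image.
Variables (R : pzRingType) (U : lalgType R) (V : pzAlgType R).
Variable f : {lrmorphism U -> V}.

Definition image_pred : {pred V} := fun x => `[< exists y, f y = x >].

Record image_alg := ImageAlg { image_val :> V; _ : image_val \in image_pred }.

HB.instance Definition _ := [isSub for image_val].
HB.instance Definition _ := [Choice of image_alg by <:].

Fact image_subring_closed : subring_closed image_pred.
Proof.
split=> [|_ _ /asboolP[x <-] /asboolP[y <-]|_ _ /asboolP[x <-] /asboolP[y <-]].
- by apply/asboolP; exists 1; rewrite rmorph1.
- by apply/asboolP; exists (x - y); rewrite rmorphB.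
- by apply/asboolP; exists (x * y); rewrite rmorphM.
Qed.

Fact image_subsemimod_closed : subsemimod_closed image_pred.
Proof.
split; first split=> [|_ _ /asboolP[x <-] /asboolP[y <-]].
- by apply/asboolP; exists 0; rewrite rmorph0.
- by apply/asboolP; exists (x + y); rewrite rmorphD.
by move=> a _ /asboolP[x <-]; apply/asboolP; exists (a *: x); rewrite linearZ.
Qed.

HB.instance Definition _ := GRing.SubChoice_isSubPzRing.Build V image_pred
  image_alg image_subring_closed.
HB.instance Definition _ := GRing.SubZmodule_isSubLmodule.Build R V image_pred
  image_alg image_subsemimod_closed.

Fact image_scalerAl (a : R) (u v : image_alg) : a *: (u * v) = (a *: u) * v.
Proof. by apply: val_inj; rewrite /= pzscalerAl. Qed.
Fact image_scalerAr (a : R) (u v : image_alg) : a *: (u * v) = u * (a *: v).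
Proof. by apply: val_inj; rewrite /= pzscalerAr. Qed.

HB.instance Definition _ :=
  PzRing_Lmodule_isPzAlgebra.Build R image_alg image_scalerAl image_scalerAr.

End Image.

(* B / t B, as an algebra over F, for B an algebra over F{t} *)
Section QuotientByT.
Variables (F : comNzRingType) (B : pzAlgType (fps F)).
Implicit Types (x y z : B) (a b : F).

Definition tquot_rel x y : bool := `[< exists z, x - y = fps_t *: z >].

Fact tquot_rel_equiv : equiv_class_of tquot_rel.
Proof.
split=> [x|x y|y x z].
- by apply/asboolP; exists 0; rewrite subrr scaler0.
- by apply/asboolP/asboolP=> -[z e]; exists (- z); rewrite scalerN -e opprB.
- move=> /asboolP[u eu] /asboolP[v ev]; apply/asboolP; exists (u + v).
  by rewrite scalerDr -eu -ev addrA subrK.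
Qed.

Canonical tquot_equiv := EquivRelPack tquot_rel_equiv.
Canonical tquot_encModRel := defaultEncModRel tquot_rel.

Definition tquot := {eq_quot tquot_rel}.
HB.instance Definition _ : EqQuotient B tquot_rel tquot := EqQuotient.on tquot.
HB.instance Definition _ := Choice.on tquot.

Lemma tquotP x y :
  reflect (exists z, x - y = fps_t *: z) (x == y %[mod tquot]).
Proof. by rewrite piE; apply: asboolP. Qed.

Definition tquot_zero : tquot := lift_cst tquot 0.
Definition tquot_opp := lift_op1 tquot -%R.
Definition tquot_add := lift_op2 tquot +%R.
Definition tquot_one : tquot := lift_cst tquot 1.
Definition tquot_mul := lift_op2 tquot *%R.
Definition tquot_scale a := lift_op1 tquot ( *:%R (fps_const a)).

Canonical pi_tquot_zero := PiConst tquot_zero.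
Canonical pi_tquot_one := PiConst tquot_one.

Lemma repr_tquot x : exists z, x - repr (\pi_tquot x) = fps_t *: z.
Proof. by apply/tquotP; rewrite reprK. Qed.

Lemma pi_tquot_opp_subproof : {morph \pi_tquot : x / - x >-> tquot_opp x}.
Proof.
move=> x; unlock tquot_opp; apply/eqP/tquotP.
have [z e] := repr_tquot x; exists (- z).
by rewrite scalerN -e opprB opprK addrC.
Qed.
Canonical pi_tquot_opp := PiMorph1 pi_tquot_opp_subproof.

Lemma pi_tquot_add_subproof : {morph \pi_tquot : x y / x + y >-> tquot_add x y}.
Proof.
move=> x y; unlock tquot_add; apply/eqP/tquotP.
have [z ez] := repr_tquot x; have [u eu] := repr_tquot y.
by exists (z + u); rewrite scalerDr -ez -eu opprD addrACA.
Qed.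
Canonical pi_tquot_add := PiMorph2 pi_tquot_add_subproof.

Lemma pi_tquot_mul_subproof : {morph \pi_tquot : x y / x * y >-> tquot_mul x y}.
Proof.
move=> x y; unlock tquot_mul; apply/eqP/tquotP.
have [z ez] := repr_tquot x; have [u eu] := repr_tquot y.
exists (z * y + repr (\pi_tquot x) * u).
rewrite scalerDr pzscalerAl pzscalerAr -ez -eu mulrBl mulrBr.
by rewrite addrA subrK.
Qed.
Canonical pi_tquot_mul := PiMorph2 pi_tquot_mul_subproof.

Lemma pi_tquot_scale_subproof a :
  {morph \pi_tquot : x / fps_const a *: x >-> tquot_scale a x}.
Proof.
move=> x; unlock tquot_scale; apply/eqP/tquotP.
have [z ez] := repr_tquot x; exists (fps_const a *: z).
by rewrite -scalerBr ez !scalerA mulrC.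
Qed.
Canonical pi_tquot_scale a := PiMorph1 (pi_tquot_scale_subproof a).

Fact tquot_addA : associative tquot_add.
Proof. by move=> x y z; rewrite -[x]reprK -[y]reprK -[z]reprK !piE addrA. Qed.
Fact tquot_addC : commutative tquot_add.
Proof. by move=> x y; rewrite -[x]reprK -[y]reprK !piE addrC. Qed.
Fact tquot_add0 : left_id tquot_zero tquot_add.
Proof. by move=> x; rewrite -[x]reprK !piE add0r. Qed.
Fact tquot_addN : left_inverse tquot_zero tquot_opp tquot_add.
Proof. by move=> x; rewrite -[x]reprK !piE addNr. Qed.
HB.instance Definition _ :=
  GRing.isZmodule.Build tquot tquot_addA tquot_addC tquot_add0 tquot_addN.

Fact tquot_mulA : associative tquot_mul.
Proof. by move=> x y z; rewrite -[x]reprK -[y]reprK -[z]reprK !piE mulrA. Qed.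
Fact tquot_mul1 : left_id tquot_one tquot_mul.
Proof. by move=> x; rewrite -[x]reprK !piE mul1r. Qed.
Fact tquot_mulr1 : right_id tquot_one tquot_mul.
Proof. by move=> x; rewrite -[x]reprK !piE mulr1. Qed.
Fact tquot_mulDl : left_distributive tquot_mul tquot_add.
Proof. by move=> x y z; rewrite -[x]reprK -[y]reprK -[z]reprK !piE mulrDl. Qed.
Fact tquot_mulDr : right_distributive tquot_mul tquot_add.
Proof. by move=> x y z; rewrite -[x]reprK -[y]reprK -[z]reprK !piE mulrDr. Qed.
HB.instance Definition _ := GRing.Zmodule_isPzRing.Build tquot
  tquot_mulA tquot_mul1 tquot_mulr1 tquot_mulDl tquot_mulDr.

Fact tquot_scaleA a b v :
  tquot_scale a (tquot_scale b v) = tquot_scale (a * b) v.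
Proof. by rewrite -[v]reprK !piE scalerA rmorphM. Qed.
Fact tquot_scale1 : left_id 1 tquot_scale.
Proof. by move=> v; rewrite -[v]reprK !piE rmorph1 scale1r. Qed.
Fact tquot_scaleDr : right_distributive tquot_scale tquot_add.
Proof. by move=> a u v; rewrite -[u]reprK -[v]reprK !piE scalerDr. Qed.
Fact tquot_scaleDl v :
  {morph tquot_scale^~ v : a b / a + b >-> tquot_add a b}.
Proof. by move=> a b; rewrite -[v]reprK !piE rmorphD scalerDl. Qed.
HB.instance Definition _ := GRing.Zmodule_isLmodule.Build F tquot
  tquot_scaleA tquot_scale1 tquot_scaleDr tquot_scaleDl.

Fact tquot_scalerAl a (u v : tquot) : a *: (u * v) = (a *: u) * v.
Proof.
change (tquot_scale a (tquot_mul u v) = tquot_mul (tquot_scale a u) v).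
by rewrite -[u]reprK -[v]reprK !piE pzscalerAl.
Qed.
Fact tquot_scalerAr a (u v : tquot) : a *: (u * v) = u * (a *: v).
Proof.
change (tquot_scale a (tquot_mul u v) = tquot_mul u (tquot_scale a v)).
by rewrite -[u]reprK -[v]reprK !piE pzscalerAr.
Qed.
HB.instance Definition _ :=
  PzRing_Lmodule_isPzAlgebra.Build F tquot tquot_scalerAl tquot_scalerAr.

End QuotientByT.

(* S (x)_R B, as an algebra over S, for a morphism phi : R -> S; its elements are
   formal sums of pairs (c, b), standing for c (x) b, modulo the congruence
   generated by the relations of the tensor product. *)

Section ScalarExtension.
Variables (R S : comNzRingType) (phi : {rmorphism R -> S}) (B : pzAlgType R).
Implicit Types (s t u : seq (S * B)) (c : S).

Inductive tensor_eq : seq (S * B) -> seq (S * B) -> Prop :=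
| tensor_refl s : tensor_eq s s
| tensor_sym s t : tensor_eq s t -> tensor_eq t s
| tensor_trans t s u : tensor_eq s t -> tensor_eq t u -> tensor_eq s u
| tensor_cat s s' t t' :
    tensor_eq s s' -> tensor_eq t t' -> tensor_eq (s ++ t) (s' ++ t')
| tensor_perm s t : perm_eq s t -> tensor_eq s t
| tensor_0l b : tensor_eq [:: (0, b)] [::]
| tensor_Dl c c' b : tensor_eq [:: (c + c', b)] [:: (c, b); (c', b)]
| tensor_Dr c b b' : tensor_eq [:: (c, b + b')] [:: (c, b); (c, b')]
| tensor_Z c (r : R) b : tensor_eq [:: (c * phi r, b)] [:: (c, r *: b)].

Definition tensor_rel s t : bool := `[< tensor_eq s t >].

Fact tensor_rel_equiv : equiv_class_of tensor_rel.
Proof.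
split=> [s|s t|t s u].
- exact/asboolP/tensor_refl.
- by apply/asboolP/asboolP; apply: tensor_sym.
- by move=> /asboolP st /asboolP tu; apply/asboolP/(tensor_trans st tu).
Qed.

Canonical tensor_equiv := EquivRelPack tensor_rel_equiv.
Canonical tensor_encModRel := defaultEncModRel tensor_rel.

Definition scalar_ext := {eq_quot tensor_rel}.
HB.instance Definition _ : EqQuotient (seq (S * B)) tensor_rel scalar_ext :=
  EqQuotient.on scalar_ext.
HB.instance Definition _ := Choice.on scalar_ext.

Lemma scalar_extP s t : reflect (tensor_eq s t) (s == t %[mod scalar_ext]).
Proof. by rewrite piE; apply: asboolP. Qed.

Definition pair_mul (x y : S * B) : S * B := (x.1 * y.1, x.2 * y.2).
Definition tensor_mul s t := [seq pair_mul x y | x <- s, y <- t].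
Definition tensor_scale c s := [seq (c * x.1, x.2) | x <- s].

Lemma tensor_map_mull x s t : tensor_eq s t ->
  tensor_eq (map (pair_mul x) s) (map (pair_mul x) t).
Proof.
elim=> {s t} [s|s t _|t s u _ st _|s s' t t' _ ss' _ tt'|s t st|b|c c' b|c b b'|c r b].
- exact: tensor_refl.
- exact: tensor_sym.
- exact: tensor_trans.
- by rewrite !map_cat; apply: tensor_cat.
- exact/tensor_perm/perm_map.
- by rewrite /= /pair_mul /= mulr0; apply: tensor_0l.
- by rewrite /= /pair_mul /= mulrDr; apply: tensor_Dl.
- by rewrite /= /pair_mul /= mulrDr; apply: tensor_Dr.
- by rewrite /= /pair_mul /= mulrA -pzscalerAr; apply: tensor_Z.
Qed.

Lemma tensor_map_mulr y s t : tensor_eq s t ->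
  tensor_eq (map (pair_mul^~ y) s) (map (pair_mul^~ y) t).
Proof.
elim=> {s t} [s|s t _|t s u _ st _|s s' t t' _ ss' _ tt'|s t st|b|c c' b|c b b'|c r b].
- exact: tensor_refl.
- exact: tensor_sym.
- exact: tensor_trans.
- by rewrite !map_cat; apply: tensor_cat.
- exact/tensor_perm/perm_map.
- by rewrite /= /pair_mul /= mul0r; apply: tensor_0l.
- by rewrite /= /pair_mul /= mulrDl; apply: tensor_Dl.
- by rewrite /= /pair_mul /= mulrDl; apply: tensor_Dr.
- by rewrite /= /pair_mul /= mulrAC -pzscalerAl; apply: tensor_Z.
Qed.

Lemma tensor_scale_eq c s t : tensor_eq s t ->
  tensor_eq (tensor_scale c s) (tensor_scale c t).
Proof.
have E u : tensor_scale c u = map (pair_mul (c, 1)) u.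
  by apply: eq_map => x; rewrite /pair_mul mul1r.
by rewrite !E; apply: tensor_map_mull.
Qed.

Lemma tensor_mulr_eq s t t' : tensor_eq t t' ->
  tensor_eq (tensor_mul s t) (tensor_mul s t').
Proof.
move=> tt'; elim: s => [|x s IHs]; first exact: tensor_refl.
by rewrite /tensor_mul !allpairs_cons; apply: tensor_cat => //;
  apply: tensor_map_mull.
Qed.

Lemma tensor_mull_eq s s' t : tensor_eq s s' ->
  tensor_eq (tensor_mul s t) (tensor_mul s' t).
Proof.
move=> ss'; elim: t => [|y t IHt].
  have E u : tensor_mul u [::] = [::] by elim: u.
  by rewrite !E; apply: tensor_refl.
have E u : tensor_eq (tensor_mul u (y :: t))
    (map (pair_mul^~ y) u ++ tensor_mul u t).
  by apply: tensor_perm; rewrite /tensor_mul perm_allpairs_consr.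
apply: tensor_trans (E s) _; apply: tensor_trans (tensor_sym (E s')).
by apply: tensor_cat => //; apply: tensor_map_mulr.
Qed.

Lemma tensor_mul_eq s s' t t' : tensor_eq s s' -> tensor_eq t t' ->
  tensor_eq (tensor_mul s t) (tensor_mul s' t').
Proof.
move=> ss' tt'.
exact: tensor_trans (tensor_mull_eq t ss') (tensor_mulr_eq s' tt').
Qed.

Lemma tensor_mulA : associative tensor_mul.
Proof.
move=> s t u; elim: s => [//|x s IHs].
rewrite /tensor_mul !allpairs_cons allpairs_cat -!/(tensor_mul _ _) -IHs.
congr (_ ++ _); elim: t {IHs} => [//|y t IHt].
rewrite /tensor_mul /= map_cat IHt; congr (_ ++ _); rewrite -map_comp.
by apply: eq_map => z; rewrite /pair_mul /= !mulrA.
Qed.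

Lemma tensor_opp s : tensor_eq (tensor_scale (-1) s ++ s) [::].
Proof.
elim: s => [|[c b] s IHs] /=; first exact: tensor_refl.
apply: (@tensor_trans ([:: (- c, b); (c, b)] ++ (tensor_scale (-1) s ++ s))).
  rewrite mulN1r; apply: tensor_perm => /=.
  by rewrite perm_cons -cat1s perm_catCA.
rewrite -[[::]]/([::] ++ [::]); apply: tensor_cat => //.
apply: tensor_trans (tensor_sym (tensor_Dl _ _ _)) _.
by rewrite addNr; apply: tensor_0l.
Qed.

Definition ext_zero : scalar_ext := lift_cst scalar_ext [::].
Definition ext_opp := lift_op1 scalar_ext (tensor_scale (-1)).
Definition ext_add := lift_op2 scalar_ext cat.
Definition ext_one : scalar_ext := lift_cst scalar_ext [:: (1, 1)].
Definition ext_mul := lift_op2 scalar_ext tensor_mul.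
Definition ext_scale c := lift_op1 scalar_ext (tensor_scale c).

Canonical pi_ext_zero := PiConst ext_zero.
Canonical pi_ext_one := PiConst ext_one.

Lemma repr_scalar_ext s : tensor_eq s (repr (\pi_scalar_ext s)).
Proof. by apply/scalar_extP; rewrite reprK. Qed.

Lemma pi_ext_opp_subproof :
  {morph \pi_scalar_ext : s / tensor_scale (-1) s >-> ext_opp s}.
Proof.
move=> s; unlock ext_opp; apply/eqP/scalar_extP/tensor_scale_eq.
exact: repr_scalar_ext.
Qed.
Canonical pi_ext_opp := PiMorph1 pi_ext_opp_subproof.

Lemma pi_ext_add_subproof : {morph \pi_scalar_ext : s t / s ++ t >-> ext_add s t}.
Proof.
move=> s t; unlock ext_add; apply/eqP/scalar_extP.
by apply: tensor_cat; apply: repr_scalar_ext.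
Qed.
Canonical pi_ext_add := PiMorph2 pi_ext_add_subproof.

Lemma pi_ext_mul_subproof :
  {morph \pi_scalar_ext : s t / tensor_mul s t >-> ext_mul s t}.
Proof.
move=> s t; unlock ext_mul; apply/eqP/scalar_extP.
by apply: tensor_mul_eq; apply: repr_scalar_ext.
Qed.
Canonical pi_ext_mul := PiMorph2 pi_ext_mul_subproof.

Lemma pi_ext_scale_subproof c :
  {morph \pi_scalar_ext : s / tensor_scale c s >-> ext_scale c s}.
Proof.
move=> s; unlock ext_scale; apply/eqP/scalar_extP/tensor_scale_eq.
exact: repr_scalar_ext.
Qed.
Canonical pi_ext_scale c := PiMorph1 (pi_ext_scale_subproof c).

Fact ext_addA : associative ext_add.
Proof. by move=> x y z; rewrite -[x]reprK -[y]reprK -[z]reprK !piE catA. Qed.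
Fact ext_addC : commutative ext_add.
Proof.
move=> x y; rewrite -[x]reprK -[y]reprK !piE.
by apply/eqP/scalar_extP/tensor_perm; rewrite perm_catC.
Qed.
Fact ext_add0 : left_id ext_zero ext_add.
Proof. by move=> x; rewrite -[x]reprK !piE. Qed.
Fact ext_addN : left_inverse ext_zero ext_opp ext_add.
Proof.
by move=> x; rewrite -[x]reprK !piE; apply/eqP/scalar_extP/tensor_opp.
Qed.
HB.instance Definition _ :=
  GRing.isZmodule.Build scalar_ext ext_addA ext_addC ext_add0 ext_addN.

Fact ext_mulA : associative ext_mul.
Proof.
by move=> x y z; rewrite -[x]reprK -[y]reprK -[z]reprK !piE tensor_mulA.
Qed.
Fact ext_mul1 : left_id ext_one ext_mul.
Proof.
move=> x; rewrite -[x]reprK !piE; congr (\pi _).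
rewrite /tensor_mul /= cats0 -[RHS]map_id.
by apply: eq_map => -[c b]; rewrite /pair_mul !mul1r.
Qed.
Fact ext_mulr1 : right_id ext_one ext_mul.
Proof.
move=> x; rewrite -[x]reprK !piE; congr (\pi _).
elim: (repr x) => [//|[c b] s IHs]; rewrite /tensor_mul allpairs_cons.
by rewrite -/(tensor_mul _ _) IHs /= /pair_mul !mulr1.
Qed.
Fact ext_mulDl : left_distributive ext_mul ext_add.
Proof.
move=> x y z; rewrite -[x]reprK -[y]reprK -[z]reprK !piE.
by congr (\pi _); apply: allpairs_cat.
Qed.
Fact ext_mulDr : right_distributive ext_mul ext_add.
Proof.
move=> x y z; rewrite -[x]reprK -[y]reprK -[z]reprK !piE.
by apply/eqP/scalar_extP/tensor_perm; rewrite /tensor_mul perm_allpairs_catr.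
Qed.
HB.instance Definition _ := GRing.Zmodule_isPzRing.Build scalar_ext
  ext_mulA ext_mul1 ext_mulr1 ext_mulDl ext_mulDr.

Fact ext_scaleA c d v : ext_scale c (ext_scale d v) = ext_scale (c * d) v.
Proof.
rewrite -[v]reprK !piE; congr (\pi _); rewrite /tensor_scale -map_comp.
by apply: eq_map => x /=; rewrite mulrA.
Qed.
Fact ext_scale1 : left_id 1 ext_scale.
Proof.
move=> v; rewrite -[v]reprK !piE; congr (\pi _); rewrite -[RHS]map_id.
by apply: eq_map => -[c b] /=; rewrite mul1r.
Qed.
Fact ext_scaleDr : right_distributive ext_scale ext_add.
Proof.
by move=> c x y; rewrite -[x]reprK -[y]reprK !piE /tensor_scale map_cat.
Qed.
Fact ext_scaleDl v : {morph ext_scale^~ v : c d / c + d >-> ext_add c d}.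
Proof.
move=> c d; rewrite -[v]reprK !piE; apply/eqP/scalar_extP.
elim: (repr v) => [|[a b] s IHs] /=; first exact: tensor_refl.
apply: (@tensor_trans ([:: (c * a, b); (d * a, b)] ++
                       (tensor_scale c s ++ tensor_scale d s))).
  rewrite -cat1s; apply: tensor_cat => //.
  by rewrite mulrDl; apply: tensor_Dl.
by apply: tensor_perm; rewrite /= perm_cons -cat1s perm_catCA.
Qed.
HB.instance Definition _ := GRing.Zmodule_isLmodule.Build S scalar_ext
  ext_scaleA ext_scale1 ext_scaleDr ext_scaleDl.

Fact ext_scalerAl c (x y : scalar_ext) : c *: (x * y) = (c *: x) * y.
Proof.
change (ext_scale c (ext_mul x y) = ext_mul (ext_scale c x) y).
rewrite -[x]reprK -[y]reprK !piE; congr (\pi _).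
rewrite /tensor_mul /tensor_scale map_allpairs allpairs_mapl.
by apply: eq_allpairs => u v; rewrite /pair_mul /= mulrA.
Qed.
Fact ext_scalerAr c (x y : scalar_ext) : c *: (x * y) = x * (c *: y).
Proof.
change (ext_scale c (ext_mul x y) = ext_mul x (ext_scale c y)).
rewrite -[x]reprK -[y]reprK !piE; congr (\pi _).
rewrite /tensor_mul /tensor_scale map_allpairs allpairs_mapr.
by apply: eq_allpairs => u v; rewrite /pair_mul /= mulrCA.
Qed.
HB.instance Definition _ :=
  PzRing_Lmodule_isPzAlgebra.Build S scalar_ext ext_scalerAl ext_scalerAr.

End ScalarExtension.

(* [K] with [iota] plays the role of C{{t}}, which is only defined up to
   isomorphism. *)
Definition is_algebraic_closure (E : fieldType) (K : closedFieldType)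
    (iota : {rmorphism E -> K}) : Prop :=
  forall x : K, algebraicOver iota x.

Definition is_deformation (F : fieldType) (N : pzAlgType F)
    (B : pzAlgType (fps F)) : Prop :=
  free_module B /\
  exists f : {rmorphism tquot B -> N},
    [/\ scalable f, bijective f
      (* [N] sits in [B] as a lift of [B / t B], its identity being that of [B] *)
      & exists j : {additive N -> B},
          [/\ forall a x, j (a *: x) = fps_const a *: j x,
              forall x, f (\pi_(tquot B) (j x)) = x
            & j 1 = 1]].

Section FlatDeformation.
Variables (F : fieldType) (K : closedFieldType).
Variable iota : {rmorphism {fraction (fps F)} -> K}.

Definition series_to_closure : {rmorphism fps F -> K} := iota \o @tofrac (fps F).
Definition const_to_closure : {rmorphism F -> K} :=
  series_to_closure \o @fps_const F.

Definition flat_deformation (N A : pzAlgType F) : Prop :=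
  exists B : pzAlgType (fps F), is_deformation N B /\
    alg_isomorphic (scalar_ext series_to_closure B)
                   (scalar_ext const_to_closure A).

End FlatDeformation.

(* Main.v *)
From HB Require Import structures.
From mathcomp Require Import all_boot all_order all_algebra fraction.
From mathcomp Require Import generic_quotient finmap monalg.
From mathcomp Require Import boolp reals complex.
From mathcomp Require Import separable ring.
Require Import Defs.

(** A deformation B of N is a free module of rank n: since B is torsion-free
    and t-adically separated, every family lifting a basis of N is a basis
    of B ([lift_basis]).  In coordinates, an isomorphism between the scalar
    extensions of B and of A to an algebraic closure K of the field of Laurent
    series is an invertible matrix that satisfies polynomial equations in the
    structure constants of B and A ([table_changeP]).

    From a flat deformation to generators: the finitely many entries of that
    matrix and of its inverse are polynomials in one element z of K, by the
    primitive element theorem.  By the Newton-Puiseux theorem ([puiseux_root],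
    obtained by rescaling and Hensel's lemma) the minimal polynomial of z gets
    a root among the Laurent series once t is replaced by a power of t.  Mapping
    z to this root preserves all polynomial equations
    ([puiseux_specialization]), so that the matrix may be assumed to have
    Laurent series as entries.  The substitution alters the structure constants
    of B, but not their constant terms, hence not the quotient by t.  The matrix
    now embeds the new algebra as a lattice L in A((t)).  This lattice contains
    some power of t times A{t}, so truncating the elements of its basis at a
    high order moves them inside tL.  By Nakayama's lemma the truncations, which
    are Laurent polynomials, still generate L ([lattice_generators]), and they
    are the images of the free variables.

    From generators to a flat deformation: the image of f is contained in
    t^(-gamma) A{t}, whence it is torsion-free and separated, and its quotient
    by t has dimension n; so it is free of rank n by [lift_basis] again.  The
    matrix of a basis of the image in terms of the t^(-gamma) a_j, for a basis
    a of A, has a nonzero determinant, so that over K it is the matrix of an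
    isomorphism ([flat_of_lattice]). *)

Set Implicit Arguments.
Unset Strict Implicit.
Unset Printing Implicit Defensive.

Import Order.TTheory GRing.Theory Num.Theory.
Local Open Scope ring_scope.
Local Open Scope quotient_scope.

(** * Power series *)

Section TPowers.
Variable A : pzRingType.

Lemma fps_coef_tXM (m : nat) (p : fps A) i :
  fps_coef (fps_t ^+ m * p) i = if (i < m)%N then 0 else fps_coef p (i - m).
Proof.
elim: m i => [|m IH] i; first by rewrite mul1r subn0.
rewrite exprS -mulrA fps_coefM.
case: i => [|i]; first by rewrite big_ord1 /= mul0r.
rewrite big_ord_recl mul0r add0r big_ord_recl /= mul1r /bump /= addn0 subn1 -[X in X + _]
  /(fps_coef (fps_t ^+ m * p) i) IH.
by rewrite ltnS subSS big1 ?addr0 // => j _; rewrite mul0r.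
Qed.

End TPowers.

Section Series.
Variable F : fieldType.
Implicit Types (p q : fps F) (k m n : nat).

Definition fps_coef0m p : F := fps_coef p 0.
Fact fps_coef0m_zmod : zmod_morphism fps_coef0m.
Proof. by []. Qed.
Fact fps_coef0m_monoid : monoid_morphism fps_coef0m.
Proof. by split=> // p q; rewrite /fps_coef0m fps_coefM big_ord1. Qed.
HB.instance Definition _ :=
  GRing.isZmodMorphism.Build (fps F) F fps_coef0m fps_coef0m_zmod.
HB.instance Definition _ :=
  GRing.isMonoidMorphism.Build (fps F) F fps_coef0m fps_coef0m_monoid.

(** Sequences of coefficients (of the inverse of a series, of the factors in
    Hensel's lemma) are obtained by solving one equation after the other. *)
Lemma course_of_values (T : Type) (x0 : T) (G : nat -> (nat -> T) -> T) :
  (forall k u v, (forall i, (i < k)%N -> u i = v i) -> G k u = G k v) ->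
  exists u, forall k, u k = G k u.
Proof.
move=> Gext.
pose pre := fix pre k := if k is k'.+1 then
  let s := pre k' in rcons s (G k' (nth x0 s)) else [::].
have size_pre k : size (pre k) = k by elim: k => //= k IH; rewrite size_rcons IH.
have nth_pre k i : (i < k)%N -> nth x0 (pre k) i = nth x0 (pre i.+1) i.
  elim: k => // k IH; rewrite ltnS leq_eqVlt => /orP[/eqP -> //|ik].
  by rewrite -IH //= nth_rcons size_pre ik.
exists (fun k => nth x0 (pre k.+1) k) => k.
rewrite /= nth_rcons size_pre ltnn eqxx; apply: Gext => i ik.
by rewrite nth_pre.
Qed.

Lemma fps_drop (m : nat) p : (forall i, (i < m)%N -> fps_coef p i = 0) ->
  p = fps_t ^+ m * Fps (fun i => fps_coef p (m + i)).
Proof.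
move=> pm; apply: fpsP => i; rewrite fps_coef_tXM.
by case: ltnP => [/pm //|mi]; rewrite /= subnKC.
Qed.

Lemma fps_t_neq0 : fps_t != 0 :> fps F.
Proof.
by apply/eqP => /(congr1 (fun p => fps_coef p 1)) /eqP; rewrite /= oner_eq0.
Qed.

(** The coefficients of the inverse are determined recursively, since the
    constant term can be divided by. *)
Lemma fps_unitP p : (p \is a GRing.unit) = (fps_coef p 0 != 0).
Proof.
apply/idP/idP => [/(rmorph_unit fps_coef0m)|p0]; first by rewrite unitfE.
have [u uE] : exists u : nat -> F, forall k, u k =
    (fps_coef p 0)^-1 * ((k == 0%N)%:R
      - \sum_(i < k) u i * fps_coef p (k - i)%N).
  apply: (course_of_values 0
    (G := fun k u => (fps_coef p 0)^-1 * ((k == 0%N)%:R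
      - \sum_(i < k) u i * fps_coef p (k - i)%N))) => k u v uv.
  by congr (_ * (_ - _)); apply: eq_bigr => i _; rewrite uv.
apply/unitrPr; exists (Fps u); rewrite mulrC; apply: fpsP => k.
rewrite fps_coefM big_ord_recr /= subnn uE mulrAC mulVf // mul1r addrC subrK.
by case: k.
Qed.

Lemma fps_t_unit p : p != 0 ->
  exists k q, q \is a GRing.unit /\ p = fps_t ^+ k * q.
Proof.
move=> /fps_order[k pk lk]; exists k, (Fps (fun i => fps_coef p (k + i))).
by rewrite fps_unitP /= addn0 pk -fps_drop.
Qed.

(** The substitution of t^m for t; it is a ring morphism only for m > 0, so
    that [fps_subst m] below stands for the exponent m + 1. *)
Definition fps_subst_fun (m : nat) p : fps F :=
  Fps (fun i => if (m %| i)%N then fps_coef p (i %/ m) else 0).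

Definition fps_subst m p : fps F := fps_subst_fun m.+1 p.

Fact fps_subst_zmod m : zmod_morphism (fps_subst m).
Proof.
by move=> p q; apply: fpsP => i /=; case: ifP; rewrite ?subr0.
Qed.
Fact fps_subst_monoid m : monoid_morphism (fps_subst m).
Proof.
split=> [|p q].
  apply: fpsP => i; rewrite /=.
  case: ifP => [/dvdnP[j ->]|]; first by rewrite mulnK // muln_eq0 orbF.
  by case: i.
apply: fpsP => i; rewrite fps_coefM /=.
case: ifP => [/dvdnP[j ->]|mi].
  rewrite mulnK // (bigID (fun k : 'I_(j * m.+1).+1 => (m.+1 %| k)%N)) /=.
  rewrite [X in _ = _ + X]big1 ?addr0; last by move=> k /negPf->; rewrite mul0r.
  have lt (k : 'I_j.+1) : (k * m.+1 < (j * m.+1).+1)%N.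
    by rewrite ltnS leq_pmul2r // -ltnS.
  have lt' (k : 'I_(j * m.+1).+1) : (k %/ m.+1 < j.+1)%N.
    rewrite -(ltn_pmul2r (ltn0Sn m)) (leq_ltn_trans (leq_trunc_div _ _)) //.
    by rewrite mulSn addSn ltnS (leq_trans _ (leq_addl _ _)) // -ltnS.
  rewrite (reindex (fun k : 'I_j.+1 => Ordinal (lt k))) /=; last first.
    exists (fun k : 'I_(j * m.+1).+1 => Ordinal (lt' k)) => k.
      by move=> _; apply: val_inj; rewrite /= mulnK.
    by rewrite inE => mk; apply: val_inj; rewrite /= divnK.
  apply: eq_big => [k|k _]; first by rewrite dvdn_mull.
  by rewrite dvdn_mull // mulnK // -mulnBl dvdn_mull // mulnK.
rewrite big1 // => k _; case: ifP => mk; last by rewrite mul0r.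
case: ifP => mik; last by rewrite mulr0.
by have := dvdn_add mk mik; rewrite subnKC ?mi // -ltnS.
Qed.
HB.instance Definition _ m := GRing.isZmodMorphism.Build (fps F) (fps F)
  (fps_subst m) (fps_subst_zmod m).
HB.instance Definition _ m := GRing.isMonoidMorphism.Build (fps F) (fps F)
  (fps_subst m) (fps_subst_monoid m).

Lemma fps_subst_coef m p i : fps_coef (fps_subst m p) (i * m.+1) = fps_coef p i.
Proof. by rewrite /= dvdn_mull // mulnK. Qed.

Lemma fps_subst_inj m : injective (fps_subst m).
Proof.
move=> p q pq; apply: fpsP => i.
by have := congr1 (fun r => fps_coef r (i * m.+1)) pq; rewrite !fps_subst_coef.
Qed.

Lemma fps_substC m a : fps_subst m (fps_const a) = fps_const a.
Proof.
apply: fpsP => i /=; case: ifP => [/dvdnP[j ->]|].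
  by rewrite mulnK // muln_eq0 orbF.
by case: i.
Qed.

Lemma fps_subst_comp m n p :
  fps_subst n (fps_subst m p) = fps_subst (n + m * n.+1) p.
Proof.
have E : (n + m * n.+1).+1 = (m.+1 * n.+1)%N by rewrite mulSn.
apply: fpsP => i; rewrite /fps_subst E /=.
case: ifP => [/dvdnP[j ->]|ni].
  by rewrite mulnK // dvdn_pmul2r // divnMr.
case: ifP => // mni; move: ni; rewrite (dvdn_trans _ mni) //.
exact: dvdn_mull.
Qed.

End Series.

(** * Hensel's lemma *)

Section Hensel.
Variable F : fieldType.
Implicit Types (p q g h : {poly fps F}) (k m n : nat).

Definition coef_at k (a : fps F) : F := fps_coef a k.
Fact coef_at_zmod k : zmod_morphism (coef_at k).
Proof. by []. Qed.
HB.instance Definition _ k := GRing.isZmodMorphism.Build (fps F) F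
  (coef_at k) (coef_at_zmod k).

(** A polynomial over power series is also a power series whose coefficients
    are polynomials of bounded degree; [tcoef k] reads the coefficient of t^k,
    and [of_tcoefs] goes back. *)
Definition tcoef k p : {poly F} := map_poly (coef_at k) p.

Lemma coef_tcoef k p i : (tcoef k p)`_i = fps_coef p`_i k.
Proof. by rewrite coef_map_id0. Qed.

Lemma tcoef_inj p q : (forall k, tcoef k p = tcoef k q) -> p = q.
Proof.
move=> pq; apply/polyP => i; apply: fpsP => k.
by rewrite -!coef_tcoef pq.
Qed.

Lemma fps_coef_sum k (I : Type) (r : seq I) (P : pred I) (G : I -> fps F) :
  fps_coef (\sum_(i <- r | P i) G i) k = \sum_(i <- r | P i) fps_coef (G i) k.
Proof. exact: (raddf_sum (coef_at k)). Qed.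

Lemma tcoefM k p q :
  tcoef k (p * q) = \sum_(i < k.+1) tcoef i p * tcoef (k - i) q.
Proof.
apply/polyP => j; rewrite coef_tcoef coefM coef_sum fps_coef_sum.
under eq_bigr do rewrite fps_coefM.
rewrite exchange_big; apply: eq_bigr => i _; rewrite coefM.
by apply: eq_bigr => l _; rewrite !coef_tcoef.
Qed.

Definition of_tcoefs n (G : nat -> {poly F}) : {poly fps F} :=
  \poly_(j < n) Fps (fun k => (G k)`_j).

Lemma of_tcoefsK n (G : nat -> {poly F}) k : (forall k, (size (G k) <= n)%N) ->
  tcoef k (of_tcoefs n G) = G k.
Proof.
move=> sG; apply/polyP => j; rewrite coef_tcoef coef_poly.
by case: ltnP => // nj; rewrite nth_default // (leq_trans (sG k)).
Qed.

(** The factors g = sum_k G_k t^k and h = sum_k H_k t^k are built degree by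
    degree.  The coefficient of t^k in the equation q = gh reads
    r_k = G_k h0 + g0 H_k, where r_k depends on earlier terms only.  By Bezout
    it has a solution with deg G_k < deg g0, and then deg H_k < deg h0 for
    reasons of degree, so that g and h are polynomials and g is monic. *)
Lemma hensel (q : {poly fps F}) (g0 h0 : {poly F}) :
  q \is monic -> map_poly (@fps_coef0m F) q = g0 * h0 -> g0 \is monic ->
  coprimep g0 h0 ->
  exists g h, [/\ q = g * h, g \is monic & size g = size g0].
Proof.
move=> qm q0 g0m co.
have tq0 : tcoef 0 q = g0 * h0 by rewrite -q0.
have h0m : h0 \is monic by rewrite -(monicMl _ g0m) -q0 monic_map.
have /Bezout_eq1_coprimepP[[v u] /= uv] := co.
have g0n := monic_neq0 g0m; have h0n := monic_neq0 h0m.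
set e := (size g0).-1; set d := (size h0).-1.
have se : size g0 = e.+1 by rewrite prednK // lt0n size_poly_eq0.
have sd : size h0 = d.+1 by rewrite prednK // lt0n size_poly_eq0.
have sq : size q = (e + d).+1.
  rewrite -(size_map_poly_id0 (f := @fps_coef0m F)) ?q0 ?size_mul ?se ?sd //.
    by rewrite addnS.
  by rewrite (monicP qm) rmorph1 oner_eq0.
(* w i is the pair (G_i, H_i). *)
pose r k (w : nat -> {poly F} * {poly F}) : {poly F} :=
  tcoef k q - \sum_(i < k | (0 < i)%N) (w i).1 * (w (k - i)%N).2.
pose W k w : {poly F} * {poly F} :=
  if k == 0%N then (g0, h0) else
  let a := (u * r k w) %% g0 in (a, (r k w - a * h0) %/ g0).
have [w wE] : exists w, forall k, w k = W k w.
  apply: (course_of_values (0, 0)) => k w w' ww'; rewrite /W.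
  suff -> : r k w = r k w' by [].
  congr (_ - _); apply: eq_bigr => i i0; rewrite !ww' //.
  by rewrite ltn_subrL i0 (leq_ltn_trans _ (ltn_ord i)).
pose G k := (w k).1; pose H k := (w k).2.
have G0 : G 0%N = g0 by rewrite /G wE.
have H0 : H 0%N = h0 by rewrite /H wE.
have GS k : (0 < k)%N -> G k = (u * r k w) %% g0.
  by case: k => // k _; rewrite /G wE.
have HS k : (0 < k)%N -> H k = (r k w - G k * h0) %/ g0.
  by case: k => // k _; rewrite /H GS // wE.
have sG k : (0 < k)%N -> (size (G k) <= e)%N.
  by move=> k0; rewrite GS // -ltnS -se ltn_modp.
have split k : (0 < k)%N -> r k w = G k * h0 + g0 * H k.
  move=> k0; suff dv : (r k w - G k * h0) %% g0 == 0.
    by rewrite HS // [X in _ + X]mulrC divpK // addrC subrK.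
  rewrite modpD modpN.
  have -> : (G k * h0) %% g0 = (u * h0 * r k w) %% g0.
    by rewrite GS // mulrC modp_mul mulrCA mulrA.
  have -> : u * h0 * r k w = r k w - g0 * (v * r k w).
    rewrite [g0 * _]mulrCA mulrA -[X in _ = X - _]mul1r -uv mulrDl.
    by rewrite addrAC subrr add0r.
  by rewrite modpD modpN modp_mulr subr0 subrr eqxx.
have sH k : (0 < k)%N -> (size (H k) <= d)%N.
  elim/ltn_ind: k => k IH k0.
  have [->|Hn] := eqVneq (H k) 0; first by rewrite size_poly0.
  have : (size (g0 * H k)%R <= e + d)%N.
    have -> : g0 * H k = r k w - G k * h0 by rewrite split // addrAC subrr add0r.
    rewrite (leq_trans (size_polyD _ _)) // geq_max size_polyN; apply/andP; split.
      rewrite (leq_trans (size_polyD _ _)) // geq_max size_polyN; apply/andP; split.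
        apply/leq_sizeP => j; rewrite leq_eqVlt coef_tcoef => /orP[/eqP<-|lt].
          have -> : q`_(e + d) = 1 by have := monicP qm; rewrite lead_coefE sq.
          by rewrite fps_coef1 (gtn_eqF k0).
        by rewrite nth_default // sq.
      apply: (leq_trans (size_sum _ _ _)); apply/bigmax_leqP => i i0.
      apply: (leq_trans (size_polyMleq _ _)).
      have := leq_add (sG i i0) (IH (k - i)%N _ _).
      rewrite ltn_subrL i0 (leq_ltn_trans _ (ltn_ord i)) // subn_gt0 ltn_ord.
      by move=> /(_ isT isT) le; apply: leq_trans le; apply: leq_pred.
    apply: (leq_trans (size_polyMleq _ _)).
    by rewrite sd addnS /= leq_add2r sG.
  rewrite size_mul // se addSn /=.
  by rewrite leq_add2l.
have sG' k : (size (G k) <= e.+1)%N.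
  by case: k => [|k]; [rewrite G0 se|rewrite (leq_trans (sG _ _))].
have sH' k : (size (H k) <= d.+1)%N.
  by case: k => [|k]; [rewrite H0 sd|rewrite (leq_trans (sH _ _))].
exists (of_tcoefs e.+1 G), (of_tcoefs d.+1 H).
have lead : (of_tcoefs e.+1 G)`_e = 1.
  rewrite coef_poly ltnSn; apply: fpsP => k; rewrite fps_coef1 /=.
  case: k => [|k]; first by have := monicP g0m; rewrite G0 lead_coefE.
  by rewrite nth_default // sG.
have sz : size (of_tcoefs e.+1 G) = e.+1.
  apply/eqP; rewrite eqn_leq size_poly ltnNge; apply/negP => /leq_sizeP/(_ e).
  by rewrite lead leqnn => /(_ isT)/eqP; rewrite oner_eq0.
split; last by rewrite sz.
  apply: tcoef_inj => k; rewrite tcoefM.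
  under eq_bigr do rewrite !of_tcoefsK //.
  case: k => [|k]; first by rewrite big_ord1 G0 H0.
  rewrite big_ord_recr big_ord_recl /= subnn subn0 G0 H0.
  have /eqP := split k.+1 isT; rewrite /r subr_eq => /eqP ->.
  rewrite big_mkcond big_ord_recl /= add0r.
  by rewrite [RHS]addrC addrA.
by rewrite monicE lead_coefE sz lead.
Qed.

End Hensel.

(** * The Newton-Puiseux theorem *)

Section Puiseux.
Variable F : closedFieldType.
Hypothesis char0 : [pchar F] =i pred0.
Implicit Types (p q g h : {poly fps F}) (k m n : nat).

Lemma coef_XsubC_exp_pred (R : comNzRingType) (c : R) n :
  (('X - c%:P) ^+ n.+1)`_n = - (n.+1%:R * c).
Proof.
elim: n => [|n IH]; first by rewrite expr1 coefB coefX coefC /= sub0r mul1r.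
have lead1 m : (('X - c%:P) ^+ m)`_m = 1.
  have := monic_exp m (monicXsubC c).
  by rewrite monicE lead_coefE size_exp_XsubC => /eqP.
rewrite exprSr mulrBr coefB coefMX coefMC /= IH lead1 mul1r.
by rewrite -opprD -[X in _ + X]mul1r -mulrDl natr1.
Qed.

Lemma coef_tschirnhaus (R : idomainType) (p : {poly R}) (c : R) n :
  p \is monic -> size p = n.+2 ->
  (p \Po ('X - c%:P))`_n = p`_n - n.+1%:R * c.
Proof.
move=> pm sp; have pn : p`_n.+1 = 1.
  by move: pm; rewrite monicE lead_coefE sp => /eqP.
rewrite comp_polyE sp big_ord_recr big_ord_recr /= !coefD !coefZ pn mul1r.
rewrite coef_XsubC_exp_pred coef_sum big1 ?add0r => [|i _].
  have := monic_exp n (monicXsubC c).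
  by rewrite monicE lead_coefE size_exp_XsubC => /eqP /= ->; rewrite mulr1.
by rewrite coefZ [X in _ * X]nth_default ?mulr0 // size_exp_XsubC.
Qed.

(** Let o(i) be the order of the i-th coefficient, and let d = n + 1 be the
    degree.  The slopes o(i) / (d - i) become integers after the substitution
    t -> t^(d!).  With k the smallest of them, t^(-kd) p(t^k x) has integral
    coefficients, and the coefficient where the minimum is attained becomes a
    unit.  Thus the reduction of this polynomial is not X^d, although its
    subleading coefficient vanishes.  The last clause transfers roots, also
    after a further substitution s. *)
Lemma puiseux_rescale p n : p \is monic -> size p = n.+2 -> p`_n = 0 ->
    p != 'X^(n.+1) ->
  exists m k q, [/\ q \is monic, size q = n.+2, q`_n = 0,
    map_poly (@fps_coef0m F) q != 'X^(n.+1)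
    & forall (s : {rmorphism fps F -> fps F}) y,
      (map_poly s (map_poly (fps_subst m) p)).[s fps_t ^+ k * y] =
      s fps_t ^+ (k * n.+1) * (map_poly s q).[y]].
Proof.
move=> pm sp pn pX.
have pl : p`_n.+1 = 1 by move: pm; rewrite monicE lead_coefE sp => /eqP.
have [o oP] : exists o : nat -> nat, forall i, p`_i != 0 ->
    fps_coef p`_i (o i) != 0 /\ forall j, (j < o i)%N -> fps_coef p`_i j = 0.
  suff /choice[o oP] : forall i, exists o : nat, p`_i != 0 ->
    fps_coef p`_i o != 0 /\ forall j, (j < o)%N -> fps_coef p`_i j = 0 by exists o.
  move=> i; have [->|/fps_order[o po ol]] := eqVneq p`_i 0.
    by exists 0%N; rewrite eqxx.
  by exists o.
(* The factorial is divisible by all the n + 1 - i, hence makes the slopes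
   integral. *)
pose N := (n.+1)`!; have N0 : (0 < N)%N by rewrite fact_gt0.
pose w i := (N %/ (n.+1 - i) * o i)%N.
have [i1 pi1] : exists i : 'I_n.+1, p`_i != 0.
  apply: contrapT => /forallNP pi; case/eqP: pX; apply/polyP => i.
  rewrite coefXn; case: (ltngtP i n.+1) => [lt|gt|->]; last by rewrite pl.
    by have /negP := pi (Ordinal lt); rewrite negbK => /eqP.
  by rewrite nth_default // sp.
case: (@arg_minnP _ i1 (fun i : 'I_n.+1 => p`_i != 0) (fun i => w i) pi1)
  => i0 pi0 min0.
set k := w i0 in min0.
pose m := N.-1; have mN : m.+1 = N by rewrite prednK.
have wN i : (i < n.+1)%N -> (w i * (n.+1 - i) = o i * N)%N.
  move=> lt; rewrite /w mulnAC divnK 1?mulnC //.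
  by apply: dvdn_fact; rewrite subn_gt0 lt leq_subr.
pose b i := fps_subst m p`_i.
have b_low i j : (j < k * (n.+1 - i))%N -> fps_coef (b i) j = 0.
  have [ni|lt] := leqP n.+1 i.
    by move: ni; rewrite -subn_eq0 => /eqP->; rewrite muln0.
  move=> jk; rewrite /b; have [->|pi] := eqVneq p`_i 0; first by rewrite rmorph0.
  rewrite /= mN; case: ifP => // /dvdnP[l jl]; rewrite jl mulnK //.
  have [_ ->//] := oP _ pi; rewrite -(ltn_pmul2r N0) -jl -wN //.
  by apply: leq_trans jk _; rewrite leq_pmul2r ?subn_gt0 // (min0 (Ordinal lt)).
pose q := \poly_(i < n.+2) Fps (fun l => fps_coef (b i) (k * (n.+1 - i) + l)).
have bq i : (i < n.+2)%N -> b i = fps_t ^+ (k * (n.+1 - i)) * q`_i.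
  by move=> lt; rewrite coef_poly lt -fps_drop // => j; apply: b_low.
have ql : q`_n.+1 = 1.
  by have := bq n.+1 (ltnSn _); rewrite /b pl rmorph1 subnn muln0 mul1r => <-.
have sq : size q = n.+2.
  apply/eqP; rewrite eqn_leq size_poly ltnNge; apply/negP => /leq_sizeP/(_ n.+1).
  by rewrite ql leqnn => /(_ isT)/eqP; rewrite oner_eq0.
have qn : q`_n = 0.
  apply/eqP; have := bq n (leqnSn _); rewrite /b pn rmorph0 => /esym/eqP.
  by rewrite mulf_eq0 expf_eq0 (negPf (fps_t_neq0 F)) andbF.
exists m, k, q; split=> //.
- by rewrite monicE lead_coefE sq ql.
- apply/eqP => /(congr1 (fun r : {poly F} => r`_i0)) /eqP.
  rewrite coefXn ltn_eqF // coef_map_id0 // coef_poly ltnS ltnW //=.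
  rewrite /fps_coef0m /= addn0 wN // mN dvdn_mull // mulnK //.
  by have [/negPf->] := oP _ pi0.
move=> s y.
have si (r : {poly fps F}) :
    (size r <= n.+2)%N -> (size (map_poly s r) <= n.+2)%N.
  by apply: leq_trans; apply: size_poly.
rewrite (horner_coef_wide _ (si _ _)); last first.
  by apply: leq_trans (size_poly _ _) _; rewrite sp.
rewrite (horner_coef_wide _ (si _ _)) ?sq // mulr_sumr; apply: eq_bigr => i _.
rewrite !coef_map /= -[fps_subst m _]/(b i) bq // rmorphM rmorphXn exprMn -exprM.
rewrite mulrCA !mulrA -exprD -mulnDr subnKC -1?ltnS //.
Qed.

(** Induction on the degree d.  The translation by the subleading coefficient
    divided by d makes this coefficient vanish.  After rescaling, the reduction
    modulo t is not X^d; as its subleading coefficient is zero, it is not a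
    d-th power of X - a either.  So a root a of the reduction has a multiplicity
    e with 0 < e < d, and Hensel's lemma splits off a factor of degree e. *)
Lemma puiseux_root n p : p \is monic -> size p = n.+2 ->
  exists m y, root (map_poly (fps_subst m) p) y.
Proof.
elim/ltn_ind: n p => n IH p pm sp.
wlog pn : p pm sp / p`_n = 0.
  move=> depressed; pose c := fps_const ((n.+1%:R)^-1 : F) * p`_n.
  have nc : n.+1%:R * c = p`_n.
    rewrite /c mulrA -[_%:R](rmorph_nat (@fps_const F)) -rmorphM divff ?mul1r //.
    by have /pcharf0P -> := char0.
  have s2 : size ('X - c%:P) = 2 by rewrite size_XsubC.
  have [||| m [y ry]] := depressed (p \Po ('X - c%:P)).
  - by rewrite monicE lead_coef_comp ?s2 // (monicP pm) lead_coefXsubC expr1n mulr1.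
  - by rewrite size_comp_poly2 ?s2.
  - by rewrite coef_tschirnhaus // nc subrr.
  exists m, (y - fps_subst m c).
  move: ry; rewrite /root map_comp_poly horner_comp rmorphB /= map_polyX map_polyC.
  by rewrite hornerXsubC.
have [->|pX] := eqVneq p 'X^(n.+1).
  by exists 0%N, 0; rewrite /root map_polyXn hornerXn expr0n.
have [m [k [q [qm sq qn q0X qE]]]] := puiseux_rescale pm sp pn pX.
set q0 := map_poly _ q in q0X.
have q0m : q0 \is monic by rewrite /q0 monic_map.
have sq0 : size q0 = n.+2.
  by rewrite size_map_poly_id0 // (monicP qm) rmorph1 oner_eq0.
have [a ra] : exists a, root q0 a by apply/closed_rootP; rewrite sq0.
have [e [h0 h0a q0E]] := multiplicity_XsubC q0 a.
rewrite monic_neq0 //= in h0a.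
have e0 : (0 < e)%N.
  by rewrite lt0n; apply: contraNneq h0a => e0; rewrite q0E e0 mulr1 in ra.
have h00 : h0 != 0 by apply: contraNneq h0a => ->; rewrite root0.
have en : (e <= n)%N.
  have := congr1 (fun r : {poly F} => size r) q0E.
  rewrite sq0 size_mul ?expf_neq0 ?polyXsubC_eq0 // size_exp_XsubC addnS /=.
  have [sh|sh] := leqP (size h0) 1; last first.
    by move=> E; have := leq_add sh (leqnn e); rewrite -E !addSn add0n !ltnS.
  have sh1 : size h0 = 1%N by apply/eqP; rewrite eqn_leq sh lt0n size_poly_eq0.
  rewrite sh1 add1n => -[ne]; exfalso.
  move: (h0a) q0E; rewrite (size1_polyC sh); set c := h0`_0 => _ q0E.
  have c1 : c = 1.
    have := monicP q0m; rewrite q0E lead_coefM lead_coefC.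
    by rewrite (monicP (monic_exp _ (monicXsubC _))) mulr1.
  move: q0E; rewrite c1 mul1r -ne => q0E.
  have : q0`_n = 0 by rewrite coef_map qn.
  rewrite q0E coef_XsubC_exp_pred => /eqP; rewrite oppr_eq0 mulf_eq0.
  have /pcharf0P -> /= := char0 => /eqP a0.
  by case/eqP: q0X; rewrite q0E a0 subr0.
have [||g [h [qgh gm sg]]] := hensel qm (etrans q0E (mulrC _ _)).
- exact/monic_exp/monicXsubC.
- by apply: coprimep_expl; rewrite coprimep_sym coprimep_XsubC.
have en1 : (e.-1 < n)%N by rewrite prednK.
have [m' [y ry]] : exists m' y, root (map_poly (fps_subst m') g) y.
  by apply: (IH _ en1) => //; rewrite sg size_exp_XsubC prednK.
(* The root y of q is scaled back by t^k, itself subject to the second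
   substitution. *)
exists (m' + m * m'.+1)%N, (fps_subst m' fps_t ^+ k * y).
have -> : map_poly (fps_subst (m' + m * m'.+1)) p =
    map_poly (fps_subst m') (map_poly (fps_subst m) p).
  by apply/polyP => i; rewrite !coef_map /= fps_subst_comp.
rewrite /root qE qgh rmorphM hornerM (rootP ry) mul0r mulr0 //.
Qed.

End Puiseux.

(** * Specialization of algebraic elements to Laurent series *)

Section Fractions.
Variables (R : idomainType).
Notation E := {fraction R}.
Notation tofrac := (@tofrac R).

Lemma fraction_repr (e : E) :
  e = tofrac \n_(repr e) / tofrac \d_(repr e).
Proof.
rewrite -{1}[e]reprK; set x := repr e.
have -> : tofrac \n_x / tofrac \d_x =
    \pi_({fraction R}) (FracField.mulf (Ratio \n_x 1) (FracField.invf (Ratio \d_x 1))).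
  rewrite -[_ / _]/(FracField.mul _ (FracField.inv _)).
  by rewrite piE.
apply/eqmodP; rewrite /= /FracField.equivf /FracField.mulf /FracField.invf.
by rewrite !numden_Ratio ?mul1r ?mulr1 ?oner_eq0 ?denom_ratioP // mulrC.
Qed.

Lemma common_denominator (I : finType) (a : I -> E) :
  exists w (b : I -> R), w != 0 /\ forall i, a i * tofrac w = tofrac (b i).
Proof.
pose d i := \d_(repr (a i)).
exists (\prod_i d i), (fun i => \n_(repr (a i)) * \prod_(j | j != i) d j).
split; first by apply/prodf_neq0 => i _; apply: denom_ratioP.
move=> i; rewrite (bigD1 i) //= !rmorphM {1}[a i]fraction_repr mulrA divfK //.
by rewrite tofrac_eq0 denom_ratioP.
Qed.

Section Extension.
Variables (L : fieldType) (phi : {rmorphism R -> L}).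
Hypothesis phi_inj : injective phi.

(** The extension of an injective morphism to the field of fractions; the
    injectivity proof is an argument because the morphism structure of
    [fracmap] depends on it. *)
Definition fracmap of injective phi := fun e : E =>
  phi \n_(repr e) / phi \d_(repr e).
Notation g := (fracmap phi_inj).

Let phi_neq0 b : b != 0 -> phi b != 0.
Proof. by apply: contra => /eqP; rewrite -(rmorph0 phi) => /phi_inj ->. Qed.

Lemma fracmapE e a b : b != 0 -> e * tofrac b = tofrac a -> g e = phi a / phi b.
Proof.
move=> b0 ea; rewrite /fracmap; set n := \n_ _; set d := \d_ _.
have d0 : d != 0 := denom_ratioP _.
apply/eqP; rewrite eqr_div ?phi_neq0 // -!rmorphM (inj_eq phi_inj).
rewrite -tofrac_eq !rmorphM /= -ea {1}[e]fraction_repr -/n -/d.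
by rewrite -[X in _ == X]mulrAC divfK // ?tofrac_eq0.
Qed.

Let denom e : exists a b, b != 0 /\ e * tofrac b = tofrac a.
Proof.
exists \n_(repr e), \d_(repr e); split; first exact: denom_ratioP.
by rewrite {1}[e]fraction_repr divfK ?tofrac_eq0 ?denom_ratioP.
Qed.

Lemma fracmap_tofrac a : g (tofrac a) = phi a.
Proof.
by rewrite (@fracmapE _ a 1) ?oner_eq0 ?rmorph1 ?mulr1 ?divr1.
Qed.

Fact fracmap_zmod : zmod_morphism g.
Proof.
move=> e e'; have [a [b [b0 eb]]] := denom e; have [c [d [d0 ed]]] := denom e'.
rewrite (fracmapE b0 eb) (fracmapE d0 ed) -mulNr addf_div ?phi_neq0 //.
rewrite (@fracmapE _ (a * d + (- c) * b) (b * d)) ?mulf_neq0 //.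
  by rewrite rmorphD !rmorphM rmorphN.
by rewrite rmorphD !rmorphM rmorphN /= -eb -ed; ring.
Qed.
Fact fracmap_monoid : monoid_morphism g.
Proof.
split=> [|e e']; first by rewrite -[1](rmorph1 tofrac) fracmap_tofrac rmorph1.
have [a [b [b0 eb]]] := denom e; have [c [d [d0 ed]]] := denom e'.
rewrite (fracmapE b0 eb) (fracmapE d0 ed) mulf_div -!rmorphM.
by apply: fracmapE; rewrite ?mulf_neq0 // !rmorphM /= -eb -ed mulrACA.
Qed.
HB.instance Definition _ := GRing.isZmodMorphism.Build E L g fracmap_zmod.
HB.instance Definition _ := GRing.isMonoidMorphism.Build E L g fracmap_monoid.

End Extension.

(** If w is a common denominator of the coefficients of p, then
    w^(n+1) p(x/w) is monic with integral coefficients.  The relation between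
    the two polynomials is stated along an arbitrary morphism, as it is used
    after a substitution for t. *)
Lemma integral_multiple (p : {poly E}) n : p \is monic -> size p = n.+2 ->
  exists w (q : {poly R}), [/\ w != 0, q \is monic, size q = n.+2
    & forall (L : fieldType) (phi : {rmorphism E -> L}) y,
      (map_poly (phi \o tofrac) q).[phi (tofrac w) * y] =
      phi (tofrac w) ^+ n.+1 * (map_poly phi p).[y]].
Proof.
move=> pm sp; have pl : p`_n.+1 = 1 by move: pm; rewrite monicE lead_coefE sp => /eqP.
have [w [b [w0 bE]]] := common_denominator (fun i : 'I_n.+1 => p`_i).
pose c i : R := if insub i is Some j then b j * w ^+ (n - i) else (i == n.+1)%:R.
have cE i : (i < n.+2)%N -> tofrac (c i) = p`_i * tofrac w ^+ (n.+1 - i).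
  rewrite /c ltnS leq_eqVlt => /orP[/eqP ->|lt].
    by rewrite insubF ?ltnn // eqxx pl subnn !mul1r rmorph1.
  rewrite (insubT (fun i => i < n.+1)%N lt) /= subSn // rmorphM rmorphXn.
  by rewrite /= -bE /= exprS mulrA.
have cn : c n.+1 = 1 by rewrite /c insubF ?ltnn // eqxx.
exists w, (\poly_(i < n.+2) c i); rewrite monicE lead_coef_poly ?cn ?oner_eq0 //.
rewrite size_poly_eq ?cn ?oner_eq0 //; split=> // L phi y.
have si (S T : nzRingType) (s : S -> T) (r : {poly S}) :
  (size r <= n.+2)%N -> (size (map_poly s r) <= n.+2)%N.
  by apply: leq_trans; apply: size_poly.
rewrite (horner_coef_wide _ (si _ _ _ _ (size_poly _ _))).
rewrite (horner_coef_wide _ (si _ _ _ _ _)) ?sp // mulr_sumr.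
apply: eq_bigr => i _; rewrite !coef_map coef_poly ltn_ord /= cE // rmorphM.
rewrite rmorphXn exprMn -mulrA [RHS]mulrCA; congr (_ * _); rewrite mulrA -exprD.
by rewrite subnK // -ltnS.
Qed.

End Fractions.

Section Specialization.
Variables (F K : closedFieldType) (iota : {rmorphism {fraction (fps F)} -> K}).
Hypothesis char0 : [pchar F] =i pred0.
Hypothesis iota_closure : is_algebraic_closure iota.
Notation E := {fraction (fps F)}.
Notation tofrac := (@tofrac (fps F)).

Lemma fraction_char0 : [pchar E] =i pred0.
Proof.
apply/pcharf0P => n; rewrite -(rmorph_nat tofrac) tofrac_eq0.
have /pcharf0P <- := char0; rewrite -(rmorph_nat (@fps_const F)).
apply/eqP/eqP => [/(congr1 (fun a => fps_coef a 0)) //|->]; exact: rmorph0.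
Qed.

(** Induction with the primitive element theorem, which applies because the
    characteristic is zero. *)
Lemma common_generator (s : seq K) : exists z (ps : seq {poly E}),
  s = [seq (map_poly iota p).[z] | p <- ps].
Proof.
elim: s => [|x s [z [ps sE]]]; first by exists 0, [::].
have [p p0 px] := iota_closure x; have [q q0 qz] := iota_closure z.
have [n [[px' xE] [pz zE]]] := pchar0_PET p0 px q0 qz fraction_char0.
exists (z *+ n - x), (px' :: [seq r \Po pz | r <- ps]); rewrite /= xE.
congr (_ :: _); rewrite sE -map_comp; apply: eq_map => r /=.
by rewrite map_comp_poly horner_comp zE.
Qed.

Lemma minimal_polynomial z : exists n (p : {poly E}),
  [/\ p \is monic, size p = n.+2
    & forall q, (map_poly iota q).[z] = 0 -> p %| q].
Proof.
pose P d := `[< exists2 p : {poly E},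
  p != 0 /\ size p = d & root (map_poly iota p) z >].
have exP : exists d, P d.
  have [p p0 pz] := iota_closure z; exists (size p); apply/asboolP.
  by exists p.
have [d /asboolP[p [p0 sp] pz] mind] := ex_minnP exP.
have lc0 : (lead_coef p)^-1 != 0 by rewrite invr_eq0 lead_coef_eq0.
have d2 : (1 < d)%N.
  rewrite -sp ltnNge; apply/negP => /size1_polyC pC; move: pz p0.
  by rewrite pC map_polyC rootC fmorph_eq0 polyC_eq0 => /eqP ->; rewrite eqxx.
exists d.-2, ((lead_coef p)^-1 *: p); split.
- by rewrite monicE lead_coefZ mulVf // lead_coef_eq0.
- by rewrite size_scale // sp; case: d d2 {sp mind} => [|[]].
move=> q qz; rewrite dvdpZl //; apply/modp_eq0P; apply: contrapT => /eqP r0.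
have : P (size (q %% p)).
  apply/asboolP; exists (q %% p) => //.
  move: qz; rewrite {1}(divp_eq q p) rmorphD rmorphM hornerD hornerM.
  by rewrite (rootP pz) mulr0 add0r /root => ->.
by move=> /mind; rewrite leqNgt -sp ltn_modp p0.
Qed.

(** Finitely many elements x_i of K are polynomials Q_i in one element z.  After
    a substitution for t the minimal polynomial of z has a root z' among the
    Laurent series.  Here [ev] is the evaluation at z and [ev'] the evaluation
    at z' combined with the substitution, so the last clause says that the
    values of the Q_i at z' satisfy every polynomial relation between
    the x_i. *)
Lemma puiseux_specialization (I : finType) (x : I -> K) :
  exists m (Q : I -> {poly E}) (ev : {rmorphism {poly E} -> K})
    (ev' : {rmorphism {poly E} -> E}),
  [/\ forall e, ev e%:P = iota e,
      forall a, ev' (tofrac a)%:P = tofrac (fps_subst m a),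
      forall i, ev (Q i) = x i
    & forall q, ev q = 0 -> ev' q = 0].
Proof.
have [z [ps xE]] := common_generator (codom x).
have [n [p [pm sp pmin]]] := minimal_polynomial z.
have [w [q [w0 qm sq qE]]] := integral_multiple pm sp.
have [m [y ry]] := puiseux_root char0 qm sq.
pose s : {rmorphism fps F -> E} := tofrac \o fps_subst m.
have s_inj : injective s.
  by move=> a b /eqP; rewrite /s /= tofrac_eq => /eqP /fps_subst_inj.
(* The substitution for t, on Laurent series. *)
pose phi : {rmorphism E -> E} := fracmap s_inj.
have phiE a : phi (tofrac a) = tofrac (fps_subst m a) by exact: fracmap_tofrac.
pose y' := tofrac y / tofrac (fps_subst m w).
have sw0 : tofrac (fps_subst m w) != 0.
  rewrite tofrac_eq0; apply: contra w0 => /eqP.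
  by move=> sw; apply/eqP/(@fps_subst_inj _ m); rewrite sw rmorph0.
have py' : (map_poly phi p).[y'] = 0.
  have := qE _ phi y'; rewrite phiE /y' mulrC divfK //.
  have -> : map_poly (phi \o tofrac) q = map_poly tofrac (map_poly (fps_subst m) q).
    by rewrite -map_poly_comp; apply: eq_map_poly => a /=; rewrite phiE.
  rewrite horner_map (rootP ry) rmorph0 => /esym/eqP.
  by rewrite mulf_eq0 expf_eq0 (negPf sw0) /= => /eqP.
exists m, (fun i => nth 0 ps (enum_rank i)).
exists (horner_eval z \o map_poly iota), (horner_eval y' \o map_poly phi).
split=> [e|a|i|r] /=.
- by rewrite /horner_eval map_polyC hornerC.
- by rewrite -phiE /horner_eval map_polyC hornerC.
- have sz : size ps = #|I| by rewrite -(size_codom x) xE size_map.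
  have xi : x i = nth 0 (codom x) (enum_rank i) by rewrite nth_codom enum_rankK.
  by rewrite xi xE (nth_map 0) // sz ltn_ord.
rewrite /horner_eval => /pmin /dvdpP[r' ->].
by rewrite rmorphM hornerM py' mulr0.
Qed.

End Specialization.

(** * Finite bases and structure constants *)

Section FiniteBases.
Variables (R : comNzRingType) (n : nat).
Implicit Types (M : lmodType R).

Lemma fin_lin_indepP M (b : 'I_n -> M) :
  lin_indep b <-> forall a, \sum_i a i *: b i = 0 -> forall i, a i = 0.
Proof.
split=> [ind a a0 i|ind s a us as0 i si].
  exact: (ind (index_enum 'I_n) a (index_enum_uniq _) a0 i (mem_index_enum _)).
pose a' j := if j \in s then a j else 0.
have /ind/(_ i) : \sum_j a' j *: b j = 0; last by rewrite /a' si.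
rewrite -[RHS]as0 [RHS]big_uniq //= [RHS]big_mkcond; apply: eq_bigr => j _.
by rewrite /a'; case: ifP; rewrite ?scale0r.
Qed.

Lemma fin_spanningP M (b : 'I_n -> M) :
  spanning b <-> forall x, exists a, x = \sum_i a i *: b i.
Proof.
split=> [sp x|sp x]; last first.
  by have [a ->] := sp x; exists (index_enum 'I_n), a.
have [s [a ->]] := sp x; elim: s => [|j s [a' IH]].
  by exists (fun=> 0); rewrite big_nil big1 // => i _; rewrite scale0r.
exists (fun i => (if i == j then a j else 0) + a' i); rewrite big_cons IH.
under [in RHS]eq_bigr do rewrite scalerDl.
rewrite big_split /=; congr (_ + _).
rewrite (bigD1 j) //= eqxx big1 ?addr0 // => i /negPf ->.
by rewrite scale0r.
Qed.

Lemma fin_basisP M (b : 'I_n -> M) :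
  is_basis b <-> (forall a, \sum_i a i *: b i = 0 -> forall i, a i = 0) /\
                 (forall x, exists a, x = \sum_i a i *: b i).
Proof. by rewrite /is_basis fin_lin_indepP fin_spanningP. Qed.

Lemma lin_indep_eq M (b : 'I_n -> M) a a' : lin_indep b ->
  \sum_i a i *: b i = \sum_i a' i *: b i -> a =1 a'.
Proof.
move=> /fin_lin_indepP ind /eqP; rewrite -subr_eq0 -sumrB.
under eq_bigr do rewrite -scalerBl.
by move=> /eqP/ind e i; apply/eqP; rewrite -subr_eq0 e.
Qed.

Lemma lincomb_mx M (b : 'I_n -> M) (a : 'I_n -> R) (A : 'M[R]_n) :
  \sum_i a i *: (\sum_j A i j *: b j) = \sum_j (\sum_i a i * A i j) *: b j.
Proof.
under eq_bigr do rewrite scaler_sumr.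
rewrite exchange_big; apply: eq_bigr => j _; rewrite scaler_suml.
by apply: eq_bigr => i _; rewrite scalerA.
Qed.

End FiniteBases.

Section BaseChange.
Variables (R : idomainType) (n : nat) (M : lmodType R).
Implicit Types (b w : 'I_n -> M) (A : 'M[R]_n).

Definition mx_family A b := fun i => \sum_j A i j *: b j.

Lemma mx_familyM A A' b : mx_family A (mx_family A' b) =1 mx_family (A *m A') b.
Proof.
by move=> i; rewrite /mx_family lincomb_mx; apply: eq_bigr => j _; rewrite mxE.
Qed.

Lemma mx_family1 b : mx_family 1%:M b =1 b.
Proof.
move=> i; rewrite /mx_family (bigD1 i) //= mxE eqxx scale1r big1 ?addr0 // => j ji.
by rewrite mxE eq_sym (negPf ji) scale0r.
Qed.

(** A vanishing determinant produces a linear relation between the rows, over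
    the domain itself. *)
Lemma mx_family_indepE A b : lin_indep b ->
  lin_indep (mx_family A b) <-> \det A != 0.
Proof.
move=> bi; have E (v : 'rV_n) : \sum_i v 0 i *: mx_family A b i =
    \sum_j (v *m A) 0 j *: b j.
  by rewrite lincomb_mx; apply: eq_bigr => j _; rewrite mxE.
split=> [/fin_lin_indepP wi|dA]; last first.
  apply/fin_lin_indepP => a; have := E (\row_i a i).
  under eq_bigr do rewrite mxE.
  move=> -> e0; move/fin_lin_indepP: bi => /(_ _ e0) e1.
  have v0 : \row_i a i = 0.
    apply: contraNeq dA => v0; apply/det0P; exists (\row_i a i) => //.
    by apply/rowP => j; rewrite e1 mxE.
  by move=> i; move/rowP: v0 => /(_ i); rewrite !mxE.
apply/det0P => -[v v0 vA]; case/eqP: v0; apply/rowP => i; rewrite mxE.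
apply: (wi (fun i => v 0 i)); rewrite E vA big1 // => j _.
by rewrite mxE scale0r.
Qed.

Lemma mx_family_spanning A b : A \in unitmx -> spanning b -> spanning (mx_family A b).
Proof.
move=> Au /fin_spanningP sp; apply/fin_spanningP => x.
have [a ->] := sp x; exists (fun i => \sum_j a j * invmx A j i).
rewrite -lincomb_mx; apply: eq_bigr => j _; congr (_ *: _).
by rewrite -[LHS]mx_family1 -(mulVmx Au) -mx_familyM.
Qed.

Lemma mx_family_basis A b : A \in unitmx -> is_basis b -> is_basis (mx_family A b).
Proof.
move=> Au [ind sp]; split; last exact: mx_family_spanning.
apply/mx_family_indepE => //; apply: contraTneq Au => dA.
by rewrite unitmxE dA unitr0.
Qed.

Lemma basis_mx b w : is_basis b -> is_basis w ->
  exists2 A, A \in unitmx & w =1 mx_family A b.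
Proof.
move=> bb wb.
have ex (u v : 'I_n -> M) : is_basis u -> exists A : 'M_n, v =1 mx_family A u.
  move=> [_ /fin_spanningP sp]; have [A AE] := choice (fun i => sp (v i)).
  exists (\matrix_(i, j) A i j) => i; rewrite [LHS]AE.
  by apply: eq_bigr => j _; rewrite mxE.
have [A AE] := ex b w bb; have [A' AE'] := ex w b wb.
exists A => //; suff /mulmx1_unit[] : A *m A' = 1%:M by [].
apply/matrixP => i j; move: j; case: (wb) => wi _; apply: (lin_indep_eq wi).
rewrite -!/(mx_family _ _ _) -mx_familyM mx_family1 AE.
by apply: eq_bigr => j _; rewrite AE'.
Qed.

End BaseChange.

Section MultTable.
Variables (R : comNzRingType) (n : nat).
Implicit Types (U V : pzAlgType R).

Definition mult_table U (w : 'I_n -> U) (beta : 'I_n -> 'I_n -> 'I_n -> R)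
    (e : 'I_n -> R) :=
  (forall i j, w i * w j = \sum_k beta i j k *: w k) /\ 1 = \sum_k e k *: w k.

Lemma basis_mult_table U (w : 'I_n -> U) : is_basis w ->
  exists beta e, mult_table w beta e.
Proof.
move=> [_ /fin_spanningP sp]; have [e eE] := sp 1.
have [c cE] := choice sp.
by exists (fun i j => c (w i * w j)), e; split.
Qed.

Lemma mult_table_prod U (w : 'I_n -> U) beta e (a a' : 'I_n -> R) :
  mult_table w beta e ->
  (\sum_i a i *: w i) * (\sum_j a' j *: w j) =
  \sum_k (\sum_i \sum_j a i * a' j * beta i j k) *: w k.
Proof.
move=> [wM _]; rewrite mulr_suml.
under eq_bigr => i _.
  rewrite mulr_sumr.
  under eq_bigr => j _.
    rewrite -pzscalerAl -pzscalerAr scalerA wM scaler_sumr.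
    under eq_bigr => k _ do rewrite scalerA.
    over.
  rewrite exchange_big.
  over.
rewrite exchange_big; apply: eq_bigr => k _; rewrite scaler_suml.
by apply: eq_bigr => i _; rewrite scaler_suml.
Qed.

(** The linear map that sends one basis to the other is multiplicative. *)
Lemma alg_iso_of_table U V (u : 'I_n -> U) (v : 'I_n -> V) beta e :
  is_basis u -> is_basis v -> mult_table u beta e -> mult_table v beta e ->
  alg_isomorphic U V.
Proof.
move=> [ui /fin_spanningP us] [vi /fin_spanningP vs] ut vt.
have [c cE] := choice us; have [d dE] := choice vs.
pose f x := \sum_i c x i *: v i; pose g y := \sum_i d y i *: u i.
have fL a : f (\sum_i a i *: u i) = \sum_i a i *: v i.
  apply: eq_bigr => i _; congr (_ *: _).
  by apply: (lin_indep_eq ui); rewrite -cE.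
have gL a : g (\sum_i a i *: v i) = \sum_i a i *: u i.
  apply: eq_bigr => i _; congr (_ *: _).
  by apply: (lin_indep_eq vi); rewrite -dE.
have fB : zmod_morphism f.
  move=> x y; rewrite (cE x) (cE y) -sumrB.
  under eq_bigr do rewrite -scalerBl.
  by rewrite !fL -sumrB; apply: eq_bigr => i _; rewrite scalerBl.
have fM : monoid_morphism f.
  split; first by case: ut vt => _ -> [_ ->]; rewrite fL.
  move=> x y; rewrite (cE x) (cE y) (mult_table_prod _ _ ut) !fL.
  by rewrite (mult_table_prod _ _ vt).
pose f1 := GRing.isZmodMorphism.Build U V f fB.
pose f2 := GRing.isMonoidMorphism.Build U V f fM.
pose h : {rmorphism U -> V} := HB.pack f f1 f2.
exists h; split.
  move=> a x; have -> : a *: x = \sum_i (a * c x i) *: u i.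
    by rewrite {1}(cE x) scaler_sumr; apply: eq_bigr => i _; rewrite scalerA.
  rewrite /= fL /f scaler_sumr; apply: eq_bigr => i _.
  by rewrite scalerA.
exists g => [x|y]; first by rewrite [in RHS](cE x) (cE x) /= fL gL.
by rewrite [in RHS](dE y) (dE y) /= gL fL.
Qed.

Lemma alg_iso_table U V (g : {rmorphism U -> V}) (u : 'I_n -> U) beta e :
  scalable g -> bijective g -> is_basis u -> mult_table u beta e ->
  is_basis (g \o u) /\ mult_table (g \o u) beta e.
Proof.
move=> gZ [h gK hK] /fin_basisP[ui us] [uM u1].
have gL a : g (\sum_i a i *: u i) = \sum_i a i *: g (u i).
  by rewrite rmorph_sum; apply: eq_bigr => i _; rewrite gZ.
split; last first.
  by split=> [i j|]; rewrite /= -?rmorphM ?uM -1?[1](rmorph1 g) ?u1 gL.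
apply/fin_basisP; split=> [a|y].
  by rewrite -gL => /(congr1 h); rewrite gK -(rmorph0 g) gK; apply: ui.
by have [a ya] := us (h y); exists a; rewrite -gL -ya hK.
Qed.

Lemma alg_isomorphic_trans U V (W : pzAlgType R) :
  alg_isomorphic U V -> alg_isomorphic V W -> alg_isomorphic U W.
Proof.
move=> [f [fZ fb]] [g [gZ gb]]; exists (g \o f); split; last exact: bij_comp.
by move=> a x; rewrite /= fZ gZ.
Qed.

End MultTable.

Section TableChange.
Variables (R : idomainType) (n : nat) (U : pzAlgType R).
Variables (u : 'I_n -> U) (alpha : 'I_n -> 'I_n -> 'I_n -> R) (eps : 'I_n -> R).
Hypothesis ut : mult_table u alpha eps.

(** The equations on A expressing that the family A u has the structure
    constants beta and e, for u with structure constants alpha and eps. *)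
Definition table_change (A : 'M[R]_n) (beta : 'I_n -> 'I_n -> 'I_n -> R)
    (e : 'I_n -> R) :=
  (forall i j r, \sum_p \sum_q A i p * A j q * alpha p q r =
                 \sum_k beta i j k * A k r)
  /\ forall r, \sum_k e k * A k r = eps r.

Lemma table_changeP A beta e : lin_indep u ->
  mult_table (mx_family A u) beta e <-> table_change A beta e.
Proof.
move=> ui; split=> -[wM w1]; split=> [i j|].
- apply: (lin_indep_eq ui); rewrite -(mult_table_prod _ _ ut).
  by rewrite -lincomb_mx -wM.
- by apply: (lin_indep_eq ui); rewrite -lincomb_mx -w1; case: ut.
- rewrite (mult_table_prod _ _ ut) lincomb_mx.
  by apply: eq_bigr => k _; rewrite wM.
rewrite lincomb_mx; case: ut => _ ->.
by apply: eq_bigr => k _; rewrite w1.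
Qed.

End TableChange.

(** * Bases of quotients by t and of scalar extensions *)

Section QuotientBases.
Variables (F : fieldType) (B : pzAlgType (fps F)).
Implicit Types (x y z : B) (c : fps F).
Notation pi := (\pi_(tquot B)).

Lemma pi_tquotD x y : pi (x + y) = pi x + pi y.
Proof. by rewrite !piE. Qed.
Lemma pi_tquotM x y : pi (x * y) = pi x * pi y.
Proof. by rewrite !piE. Qed.
Lemma pi_tquot1 : pi 1 = 1.
Proof. by rewrite !piE. Qed.
Lemma pi_tquot0 : pi 0 = 0.
Proof. by rewrite !piE. Qed.
Lemma pi_tquotZ a x : pi (fps_const a *: x) = a *: pi x.
Proof. by rewrite -[RHS]/(tquot_scale a (pi x)) piE. Qed.

Lemma fps_split c :
  c = fps_const (fps_coef c 0) + fps_t * Fps (fun i => fps_coef c i.+1).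
Proof.
apply: fpsP => i; rewrite fps_coefD -[fps_t]expr1 fps_coef_tXM.
by case: i => [|i] /=; rewrite ?addr0 // add0r subn1.
Qed.

Lemma pi_tquot_eq x y : pi x = pi y <-> exists z, x = y + fps_t *: z.
Proof.
split=> [/eqP/tquotP[z e]|[z e]].
  by exists z; rewrite -e addrC subrK.
by apply/eqP/tquotP; exists z; rewrite e addrC addKr.
Qed.

Lemma pi_tquotZ0 c x : pi (c *: x) = fps_coef c 0 *: pi x.
Proof.
rewrite -pi_tquotZ; apply/pi_tquot_eq.
exists (Fps (fun i => fps_coef c i.+1) *: x).
by rewrite {1}(fps_split c) scalerDl scalerA.
Qed.

Lemma pi_tquot_lincomb n (c : 'I_n -> fps F) (b : 'I_n -> B) :
  pi (\sum_i c i *: b i) = \sum_i fps_coef (c i) 0 *: pi (b i).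
Proof.
rewrite (big_morph _ pi_tquotD pi_tquot0).
by apply: eq_bigr => i _; rewrite pi_tquotZ0.
Qed.

Lemma tquot_basis n (b : 'I_n -> B) : is_basis b -> is_basis (pi \o b).
Proof.
move=> /fin_basisP[bi bs]; apply/fin_basisP; split=> [a|].
  pose c i := fps_const (a i).
  have -> : \sum_i a i *: (pi \o b) i = pi (\sum_i c i *: b i).
    by rewrite pi_tquot_lincomb.
  rewrite -pi_tquot0 => /pi_tquot_eq[z]; rewrite add0r.
  have [d ->] := bs z; rewrite scaler_sumr => /eqP; rewrite -subr_eq0 -sumrB.
  under eq_bigr do rewrite scalerA -scalerBl.
  move=> /eqP/bi e i; have := congr1 (fun r => fps_coef r 0) (e i).
  by rewrite fps_coefD fps_coefN -[fps_t]expr1 fps_coef_tXM /= subr0.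
elim/quotW=> y; have [c ->] := bs y.
by exists (fun i => fps_coef (c i) 0); rewrite pi_tquot_lincomb.
Qed.

Lemma tquot_table n (b : 'I_n -> B) beta e : mult_table b beta e ->
  mult_table (pi \o b) (fun i j k => fps_coef (beta i j k) 0)
    (fun k => fps_coef (e k) 0).
Proof.
move=> [bM b1]; split=> [i j|]; last by rewrite -pi_tquot1 b1 pi_tquot_lincomb.
by rewrite /= -pi_tquotM bM pi_tquot_lincomb.
Qed.

Section Lifting.
Hypothesis torsion_free : forall x, fps_t *: x = 0 -> x = 0.
Hypothesis separated :
  forall x, (forall k, exists z, x = fps_t ^+ k *: z) -> x = 0.

(** Independence: a relation between the b_i reduces to a relation modulo t, so
    all its coefficients are divisible by t; dividing by t, which is possible in
    the absence of torsion, and repeating, all coefficients vanish.  Generation: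
    write x = sum_i a_i b_i + t x' with constant a_i, then treat x' likewise;
    the resulting series c_i satisfy x = sum_i c_i b_i up to t^k B for all k,
    hence exactly. *)
Lemma lift_basis n (b : 'I_n -> B) : is_basis (pi \o b) -> is_basis b.
Proof.
move=> /fin_basisP[bi bs]; apply/fin_basisP; split=> [c c0 i|x].
  have const0 d : \sum_i d i *: b i = 0 -> forall i, fps_coef (d i) 0 = 0.
    move=> d0; apply: (bi (fun i => fps_coef (d i) 0)).
    by rewrite -[LHS]pi_tquot_lincomb d0 pi_tquot0.
  apply: fpsP => k; rewrite fps_coef0; elim: k c c0 i => [|k IH] c c0 i.
    exact: const0.
  apply: (IH (fun j => Fps (fun l => fps_coef (c j) l.+1))).
  apply: torsion_free; rewrite scaler_sumr -[RHS]c0.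
  apply: eq_bigr => j _; rewrite scalerA; congr (_ *: _).
  by rewrite [RHS]fps_split const0 // rmorph0 add0r.
(* One step of the expansion of an element in powers of t. *)
have step y : exists p : ('I_n -> F) * B,
    y = \sum_i fps_const (p.1 i) *: b i + fps_t *: p.2.
  have [a ya] := bs (pi y); have : pi y = pi (\sum_i fps_const (a i) *: b i).
    by rewrite ya pi_tquot_lincomb.
  by move=> /pi_tquot_eq[z yz]; exists (a, z).
have [p pE] := choice step.
pose Z k y := iter k (fun y => (p y).2) y.
pose c y i := Fps (fun k => (p (Z k y)).1 i).
have cS y i : c y i = fps_const ((p y).1 i) + fps_t * c (p y).2 i.
  rewrite [LHS]fps_split; congr (_ + _ * _); apply: fpsP => k.
  have ZS : Z k.+1 y = Z k (p y).2 by rewrite /Z iterSr.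
  exact: (congr1 (fun z => (p z).1 i) ZS).
exists (c x); apply/eqP; rewrite -subr_eq0; apply/eqP; apply: separated => k.
elim: k x => [|k IH] x; first by eexists; rewrite scale1r.
have [z zE] := IH (p x).2; exists z; rewrite exprS -scalerA -zE.
under [in LHS]eq_bigr do rewrite cS scalerDl -scalerA.
rewrite {1}(pE x) big_split /= -scaler_sumr opprD addrACA subrr add0r.
by rewrite scalerBr.
Qed.

End Lifting.

Section FreeModules.
Variables (I : eqType) (b : I -> B).
Hypothesis bb : is_basis b.

(** Coordinates that are valid along every large enough list of indices, so
    that two elements can be compared along a common list. *)
Lemma free_coordinates x : exists (s : seq I) (a : I -> fps F),
  forall s', uniq s' -> {subset s <= s'} -> x = \sum_(i <- s') a i *: b i.
Proof.
have [_ /(_ x)[s [a ->]]] := bb.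
exists s, (fun i => a i *+ count_mem i s) => s' us' ss'.
rewrite [RHS](bigID (mem s)) /= [RHS]addrC [X in _ = X + _]big1 => [|i /count_memPn ->].
  2: by rewrite scale0r.
under [in RHS]eq_bigr do rewrite -scalerMnl.
rewrite add0r -[LHS]big_undup_iterop_count -[RHS]big_filter.
rewrite (perm_big [seq i <- s' | i \in s]) //.
apply: uniq_perm; rewrite ?undup_uniq ?filter_uniq // => i.
by rewrite mem_undup mem_filter /=; case: (boolP (i \in s)) => // /ss'.
Qed.

Lemma free_torsion_free x : fps_t *: x = 0 -> x = 0.
Proof.
have [s [a xE]] := free_coordinates x.
have us := undup_uniq s; have ss : {subset s <= undup s} by move=> i; rewrite mem_undup.
rewrite (xE _ us ss) scaler_sumr => x0.
rewrite big_seq big1 // => i si; case: bb => bi _.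
have /(bi _ (fun i => fps_t * a i) us)/(_ i si)/eqP :
  \sum_(i <- undup s) (fps_t * a i) *: b i = 0.
  by rewrite -[RHS]x0; apply: eq_bigr => j _; rewrite scalerA.
by rewrite mulf_eq0 (negPf (fps_t_neq0 F)) => /eqP ->; rewrite scale0r.
Qed.

Lemma free_separated x : (forall k, exists z, x = fps_t ^+ k *: z) -> x = 0.
Proof.
move=> sep; have [s [a xE]] := free_coordinates x.
have us := undup_uniq s; have ss : {subset s <= undup s} by move=> i; rewrite mem_undup.
rewrite (xE _ us ss) big_seq big1 // => i si.
suff -> : a i = 0 by rewrite scale0r.
apply: fpsP => k; have [z zE] := sep k.+1; have [s' [a' zE']] := free_coordinates z.
pose u := undup (s ++ s'); have uu : uniq u := undup_uniq _.
have su : {subset s <= u} by move=> j sj; rewrite mem_undup mem_cat sj.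
have su' : {subset s' <= u} by move=> j sj; rewrite mem_undup mem_cat sj orbT.
case: bb => bi _; have {}si : i \in s by rewrite -mem_undup.
have /(bi _ (fun i => a i - fps_t ^+ k.+1 * a' i) uu)/(_ i (su i si))/eqP :
  \sum_(i <- u) (a i - fps_t ^+ k.+1 * a' i) *: b i = 0.
  under eq_bigr do rewrite scalerBl -scalerA.
  by rewrite sumrB -scaler_sumr -(xE _ uu su) -(zE' _ uu su') zE subrr.
rewrite subr_eq0 => /eqP ->.
by rewrite fps_coef_tXM ltnSn.
Qed.

End FreeModules.

End QuotientBases.

Section ScalarExtensionBases.
Variables (R S : comNzRingType) (phi : {rmorphism R -> S}) (B : pzAlgType R).
Implicit Types (x y : B) (c d : S).

Definition tensor c x : scalar_ext phi B := \pi [:: (c, x)].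

Lemma tensor_consE c x s :
  \pi_(scalar_ext phi B) ((c, x) :: s) = tensor c x + \pi s.
Proof. by rewrite /tensor !piE. Qed.

Lemma tensorDr c x y : tensor c (x + y) = tensor c x + tensor c y.
Proof.
rewrite /tensor !piE; apply/eqP/scalar_extP; exact: tensor_Dr.
Qed.
Lemma tensorZr c (r : R) x : tensor c (r *: x) = tensor (c * phi r) x.
Proof. by apply/eqP/scalar_extP/tensor_sym/tensor_Z. Qed.
Lemma tensorZ c d x : c *: tensor d x = tensor (c * d) x.
Proof. by rewrite -[LHS]/(ext_scale c _) /tensor piE. Qed.
Lemma tensorM c d x y : tensor c x * tensor d y = tensor (c * d) (x * y).
Proof. by rewrite /tensor !piE. Qed.
Lemma tensor1 : tensor 1 1 = 1.
Proof. by rewrite /tensor !piE. Qed.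
Lemma tensor0r c : tensor c 0 = 0.
Proof.
rewrite -(scale0r (0 : B)) tensorZr rmorph0 mulr0.
by rewrite -(scale0r (tensor 0 0)) tensorZ mul0r.
Qed.

Lemma tensor_lincomb n (b : 'I_n -> B) (a : 'I_n -> R) c :
  tensor c (\sum_i a i *: b i) = \sum_i (c * phi (a i)) *: tensor 1 (b i).
Proof.
rewrite (big_morph _ (tensorDr c) (tensor0r c)); apply: eq_bigr => i _.
by rewrite tensorZr tensorZ mulr1.
Qed.

(** Independence comes from the coordinate maps c (x) x -> c phi(x_j), which are
    constant on the classes of the congruence defining the tensor product. *)
Lemma ext_basis n (b : 'I_n -> B) : is_basis b -> is_basis (tensor 1 \o b).
Proof.
move=> /fin_basisP[bi bs]; apply/fin_basisP.
have [c cE] := choice bs.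
have cL a : c (\sum_i a i *: b i) =1 a.
  by move/fin_lin_indepP in bi; apply: (lin_indep_eq bi); rewrite -cE.
have cD x y i : c (x + y) i = c x i + c y i.
  rewrite -(cL (fun i => c x i + c y i)); congr (c _ i).
  under eq_bigr do rewrite scalerDl.
  by rewrite big_split -!cE.
have cZ r x i : c (r *: x) i = r * c x i.
  rewrite -(cL (fun i => r * c x i)); congr (c _ i).
  by rewrite [in LHS](cE x) scaler_sumr; apply: eq_bigr => j _; rewrite scalerA.
(* The j-th coordinate, on representatives. *)
pose psi j (s : seq (S * B)) := \sum_(p <- s) p.1 * phi (c p.2 j).
have psiE j s t : tensor_eq phi s t -> psi j s = psi j t.
  rewrite /psi; elim=> {s t}
    [s|s t _ -> //|t s u _ -> _ -> //|s s' t t' _ e _ e'|s t st|x|d d' x|d x y|d r x].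
  - by [].
  - by rewrite !big_cat e e'.
  - exact: perm_big.
  - by rewrite big_seq1 big_nil /= mul0r.
  - by rewrite big_seq1 big_cons big_seq1 /= mulrDl.
  - by rewrite big_seq1 big_cons big_seq1 /= cD rmorphD mulrDr.
  by rewrite !big_seq1 /= cZ rmorphM mulrA.
split=> [a a0 j|].
  pose s := [seq (a i, b i) | i <- index_enum 'I_n].
  have sE : \pi_(scalar_ext phi B) s = 0.
    rewrite -a0 /s; elim: (index_enum _) => [|i r IH] /=.
      by rewrite big_nil -[RHS]/(ext_zero phi B) piE.
    by rewrite tensor_consE IH big_cons /= tensorZ mulr1.
  have : psi j s = psi j [::].
    apply: psiE; apply/scalar_extP/eqP; rewrite sE.
    by rewrite -[LHS]/(ext_zero phi B) piE.
  have cb i : c (b i) j = (j == i)%:R.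
    rewrite -(cL (fun l => (l == i)%:R) j); congr (c _ j).
    rewrite (bigD1 i) //= eqxx scale1r big1 ?addr0 // => l /negPf ->.
    by rewrite scale0r.
  rewrite /psi big_nil big_map (bigD1 j) //= big1 ?addr0 => [|i ij].
    by rewrite cb eqxx rmorph1 mulr1.
  by rewrite cb eq_sym (negPf ij) rmorph0 mulr0.
elim/quotW => s; elim: s => [|[d x] s [a IH]].
  exists (fun=> 0); rewrite big1 => [|i _]; last by rewrite scale0r.
  by rewrite -[RHS]/(ext_zero phi B) piE.
exists (fun i => d * phi (c x i) + a i).
rewrite tensor_consE IH {1}(cE x) tensor_lincomb.
by rewrite -big_split; apply: eq_bigr => i _; rewrite scalerDl.
Qed.

Lemma ext_table n (b : 'I_n -> B) beta e : mult_table b beta e ->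
  mult_table (tensor 1 \o b) (fun i j k => phi (beta i j k)) (fun k => phi (e k)).
Proof.
move=> [bM b1]; split=> [i j|].
  rewrite /= tensorM bM tensor_lincomb mulr1.
  by apply: eq_bigr => k _; rewrite mul1r.
by rewrite -tensor1 b1 tensor_lincomb; apply: eq_bigr => k _; rewrite mul1r.
Qed.

End ScalarExtensionBases.

(** * Bases of Laurent series with coefficients in an algebra *)

Section Laurent.
Variables (F : fieldType) (A : pzAlgType F).
Implicit Types (c d : fps F) (f g : laurent A).

Lemma fps_in_alg_t k : fps_in_alg A (fps_t ^+ k) = fps_t ^+ k.
Proof.
elim: k => [|k IH]; first exact: fps_in_alg1.
rewrite !exprS fps_in_algM IH; congr (_ * _); apply: fpsP => i /=.
by case: (i == 1)%N; rewrite ?scale1r ?scale0r.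
Qed.

Lemma scale_shift c m (p : fps A) :
  c *: lau_shift m p = lau_shift m (fps_in_alg A c * p).
Proof. by rewrite -[LHS]/(lau_shift 0 _ * _) lau_shiftM. Qed.

Lemma lau_coef_shift m (p : fps A) i : lau_coef (lau_shift m p) i =
  if i + m%:Z is Posz j then fps_coef p j else 0.
Proof. by []. Qed.

Lemma lau_coef_tX k f i : lau_coef (fps_t ^+ k *: f) i = lau_coef f (i - k%:Z).
Proof.
have [m [p ->]] := lauW f; rewrite scale_shift fps_in_alg_t !lau_coef_shift.
have -> : i - k%:Z + m%:Z = i + m%:Z - k%:Z by rewrite addrAC.
case: (i + m%:Z) => j.
  rewrite fps_coef_tXM; case: ltnP => jk; last by rewrite subzn.
  have : j%:Z - k%:Z < 0 by rewrite subr_lt0.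
  by case: (j%:Z - k%:Z).
have : Negz j - k%:Z < 0 by rewrite ltrBlDr add0r.
by case: (Negz j - k%:Z).
Qed.

Lemma lau_torsion_free k f : fps_t ^+ k *: f = 0 -> f = 0.
Proof.
move=> tf; apply: lauP => i; have := congr1 (fun g => lau_coef g (i + k%:Z)) tf.
by rewrite lau_coef_tX addrK.
Qed.

Lemma scale_tX_shift k m (p : fps A) :
  fps_t ^+ k *: lau_shift (m + k) p = lau_shift m p.
Proof.
apply: lauP => i; rewrite lau_coef_tX /=.
by rewrite PoszD addrA addrAC subrK.
Qed.

(** The lower bound m is common to all the quotients g, so the coefficients of
    t^k g vanish below k - m. *)
Lemma lau_separated m f : (forall k, exists2 g, bounded_by m g & f = fps_t ^+ k *: g) ->
  f = 0.
Proof.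
move=> sep; apply: lauP => i; pose k := (`|i| + m).+1.
have [g gm ->] := sep k; rewrite lau_coef_tX gm // /k.
rewrite ltrBlDr addrC ltrBrDr.
apply: le_lt_trans (lerD (lez_abs i) (lexx m%:Z)) _.
by rewrite -PoszD ltz_nat.
Qed.

Section Family.
Variables (n : nat) (a : 'I_n -> A).
Hypothesis ab : is_basis a.

(** The elements t^(-m) a_j; they form a basis of t^(-m) A{t} over the power
    series. *)
Definition lau_basis m (j : 'I_n) : laurent A := lau_shift m (fps_const (a j)).

Lemma coef_in_alg_const c x i :
  fps_coef (fps_in_alg A c * fps_const x) i = fps_coef c i *: x.
Proof.
rewrite fps_coefMr big_ord_recl big1 ?addr0 => [|j _]; last by rewrite /= mulr0.
by rewrite subn0 /= -pzscalerAl mul1r.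
Qed.

Lemma lau_basis_sum m (c : 'I_n -> fps F) :
  \sum_j c j *: lau_basis m j =
  lau_shift m (Fps (fun i => \sum_j fps_coef (c j) i *: a j)).
Proof.
rewrite (eq_bigr (fun j => lau_shift m (fps_in_alg A (c j) * fps_const (a j)))).
  have s0 : lau_shift m (0 : fps A) = 0.
    by apply: lauP => i /=; case: (i + m%:Z).
  rewrite -(big_morph _ (@lau_shiftD A m) s0); congr lau_shift.
  have coef_sum i (r : seq 'I_n) (G : 'I_n -> fps A) :
      fps_coef (\sum_(j <- r) G j) i = \sum_(j <- r) fps_coef (G j) i.
    by elim: r => [|j r IH]; rewrite ?big_nil // !big_cons -IH.
  apply: fpsP => i; rewrite coef_sum /=; apply: eq_bigr => j _.
  exact: coef_in_alg_const.
by move=> j _; rewrite scale_shift.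
Qed.

Lemma lau_basis_indep m : lin_indep (lau_basis m).
Proof.
apply/fin_lin_indepP => c; rewrite lau_basis_sum => c0 j; apply: fpsP => i.
have /fin_basisP[ai _] := ab; apply: (ai (fun j => fps_coef (c j) i)).
have := congr1 (fun g => fps_coef (lau_trunc m g) i) c0.
by rewrite lau_shiftK.
Qed.

Lemma lau_basis_span m (p : fps A) : exists c : 'I_n -> fps F,
  lau_shift m p = \sum_j c j *: lau_basis m j.
Proof.
have /fin_basisP[_ as_] := ab; have [d dE] := choice as_.
exists (fun j => Fps (fun i => d (fps_coef p i) j)); rewrite lau_basis_sum.
by congr lau_shift; apply: fpsP => i; rewrite [LHS]dE.
Qed.

Lemma lau_basis_t m j : fps_t ^+ m *: lau_basis m j = lau_basis 0 j.
Proof. exact: (scale_tX_shift m 0). Qed.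

Variables (alpha : 'I_n -> 'I_n -> 'I_n -> F) (eps : 'I_n -> F).
Hypothesis a_table : mult_table a alpha eps.

Lemma lau_basis_table : mult_table (lau_basis 0)
  (fun p q r => fps_const (alpha p q r)) (fun r => fps_const (eps r)).
Proof.
have sumE (c : 'I_n -> F) :
    \sum_r fps_const (c r) *: lau_basis 0 r =
    lau_shift 0 (fps_const (\sum_r c r *: a r)).
  rewrite lau_basis_sum; congr lau_shift; apply: fpsP => -[|i] //=.
  by rewrite big1 // => j _; rewrite scale0r.
case: a_table => aM a1; split=> [p q|]; last by rewrite sumE -a1.
by rewrite sumE -aM lau_shiftM -fps_constM.
Qed.

(** The equations of [table_change] for the matrix t^(-m) C over Laurent series,
    with denominators cleared. *)
Definition scaled_table_change m (C : 'M[fps F]_n)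
    (beta : 'I_n -> 'I_n -> 'I_n -> fps F) (e : 'I_n -> fps F) :=
  (forall i j r, \sum_p \sum_q C i p * C j q * fps_const (alpha p q r) =
                 fps_t ^+ m * \sum_k beta i j k * C k r)
  /\ forall r, \sum_k e k * C k r = fps_t ^+ m * fps_const (eps r).

Lemma lau_scale_inj m f g : fps_t ^+ m *: f = fps_t ^+ m *: g -> f = g.
Proof.
move=> /eqP; rewrite -subr_eq0 -scalerBr => /eqP/lau_torsion_free/eqP.
by rewrite subr_eq0 => /eqP.
Qed.

(** The family t^(-m) a has no structure constants in F{t} in general, so both
    sides are multiplied by powers of t to compare them on the basis a itself. *)
Lemma scaled_table_changeP m C beta e :
  mult_table (mx_family C (lau_basis m)) beta e <->
  scaled_table_change m C beta e.
Proof.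
set w := mx_family _ _; have bi := @lau_basis_indep 0.
have tw i : fps_t ^+ m *: w i = mx_family C (lau_basis 0) i.
  rewrite scaler_sumr; apply: eq_bigr => j _.
  by rewrite scalerA mulrC -scalerA lau_basis_t.
have twM i j : fps_t ^+ (m + m) *: (w i * w j) =
    \sum_r (\sum_p \sum_q C i p * C j q * fps_const (alpha p q r)) *: lau_basis 0 r.
  rewrite -(mult_table_prod _ _ lau_basis_table) -!/(mx_family _ _ _) -!tw.
  by rewrite -pzscalerAl -pzscalerAr scalerA exprD.
have tS i j : fps_t ^+ (m + m) *: (\sum_k beta i j k *: w k) =
    \sum_r (fps_t ^+ m * \sum_k beta i j k * C k r) *: lau_basis 0 r.
  rewrite exprD -scalerA scaler_sumr.
  under eq_bigr do rewrite scalerA mulrC -scalerA tw.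
  rewrite lincomb_mx scaler_sumr.
  by apply: eq_bigr => r _; rewrite scalerA.
have t1 : fps_t ^+ m *: (1 : laurent A) =
    \sum_r (fps_t ^+ m * fps_const (eps r)) *: lau_basis 0 r.
  case: lau_basis_table => _ ->; rewrite scaler_sumr.
  by apply: eq_bigr => r _; rewrite scalerA.
have tE : fps_t ^+ m *: (\sum_k e k *: w k) =
    \sum_r (\sum_k e k * C k r) *: lau_basis 0 r.
  rewrite scaler_sumr -lincomb_mx; apply: eq_bigr => k _.
  by rewrite scalerA mulrC -scalerA tw.
split=> -[wM w1]; split=> [i j|].
- by apply: (lin_indep_eq bi); rewrite -twM wM tS.
- by apply: (lin_indep_eq bi); rewrite -t1 w1 tE.
- apply: (@lau_scale_inj (m + m)); rewrite twM tS.
  by apply: eq_bigr => r _; rewrite wM.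
apply: (@lau_scale_inj m); rewrite t1 tE.
by apply: eq_bigr => r _; rewrite w1.
Qed.

Lemma scaled_table_change_field (L : fieldType)
    (psi : {rmorphism fps F -> L}) m C beta e :
  injective psi ->
  scaled_table_change m C beta e <->
  table_change (fun p q r => psi (fps_const (alpha p q r)))
    (fun r => psi (fps_const (eps r)))
    ((psi (fps_t ^+ m))^-1 *: map_mx psi C)
    (fun i j k => psi (beta i j k)) (fun k => psi (e k)).
Proof.
move=> psi_inj; set s := psi (fps_t ^+ m).
have s0 : s != 0.
  apply/eqP; rewrite -(rmorph0 psi) => /psi_inj/eqP.
  by rewrite expf_eq0 (negPf (fps_t_neq0 F)) andbF.
split=> -[wM w1]; split=> [i j r|r].
- have := congr1 psi (wM i j r); rewrite rmorphM -/s !rmorph_sum /=.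
  move=> /(congr1 ( *%R (s^-1 ^+ 2))).
  rewrite [in X in _ = X -> _]expr2 -mulrA mulKf // !mulr_sumr => E.
  transitivity (\sum_k s^-1 * psi (beta i j k * C k r)).
    rewrite -E; apply: eq_bigr => p _; rewrite rmorph_sum mulr_sumr.
    apply: eq_bigr => q _; rewrite !mxE !rmorphM /=; ring.
  by apply: eq_bigr => k _; rewrite !mxE rmorphM /=; ring.
- have := congr1 psi (w1 r); rewrite rmorphM -/s rmorph_sum /=.
  move=> /(congr1 ( *%R s^-1)); rewrite mulKf // mulr_sumr => <-.
  by apply: eq_bigr => k _; rewrite !mxE rmorphM /=; ring.
- apply: psi_inj; have /(congr1 ( *%R (s ^+ 2))) := wM i j r.
  rewrite rmorphM -/s !rmorph_sum !mulr_sumr /= => E.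
  transitivity (\sum_(p < n) s ^+ 2 * (\sum_(q < n)
       (s^-1 *: map_mx psi C) i p * (s^-1 *: map_mx psi C) j q *
       psi (fps_const (alpha p q r)))).
    apply: eq_bigr => p _; rewrite rmorph_sum mulr_sumr.
    by apply: eq_bigr => q _; rewrite !mxE !rmorphM /=; field.
  rewrite E; apply: eq_bigr => k _; rewrite !mxE rmorphM /=; field.
  exact: s0.
apply: psi_inj; rewrite rmorphM -/s -w1 rmorph_sum mulr_sumr /=.
by apply: eq_bigr => k _; rewrite !mxE rmorphM /=; field.
Qed.

End Family.
End Laurent.

(** * Evaluation of noncommutative polynomials *)

Section Evaluation.
Variables (R : comNzRingType) (rho : nat) (V : pzAlgType R) (y : 'I_rho -> V).
Implicit Types (g : free_alg R rho) (w : {fmonom 'I_rho}).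

Definition word_eval w : V := \prod_(i <- (w : seq 'I_rho)) y i.
Definition free_eval g : V := \sum_(w <- msupp g) g@_w *: word_eval w.

Lemma word_evalM w w' : word_eval (mmul w w') = word_eval w * word_eval w'.
Proof. by rewrite /word_eval fmM big_cat. Qed.

Lemma free_evalEw (d : {fset {fmonom 'I_rho}}) g : (msupp g `<=` d)%fset ->
  free_eval g = \sum_(w <- d) g@_w *: word_eval w.
Proof.
move=> le; rewrite [LHS](big_fset_incl _ le) => //= w _ /mcoeff_outdom ->.
by rewrite scale0r.
Qed.

Lemma free_evalU c w : free_eval << c *g w >> = c *: word_eval w.
Proof. by rewrite (free_evalEw msuppU_le) big_seq_fset1 mcoeffUU. Qed.

Fact free_eval_zmod : zmod_morphism free_eval.
Proof.
move=> g g'; rewrite [LHS](free_evalEw (msuppB_le g g')).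
rewrite [free_eval g](free_evalEw (fsubsetUl _ (msupp g'))).
rewrite [free_eval g'](free_evalEw (fsubsetUr (msupp g) _)) -sumrB.
apply: eq_bigr => w _.
by rewrite mcoeffB scalerBl.
Qed.
HB.instance Definition _ :=
  GRing.isZmodMorphism.Build (free_alg R rho) V free_eval free_eval_zmod.

Fact free_eval_monoid : monoid_morphism free_eval.
Proof.
split=> [|g g'].
  rewrite -[LHS]/(free_eval << 1 *g mone >>) free_evalU scale1r.
  by rewrite /word_eval fm1 big_nil.
rewrite malgME raddf_sum mulr_suml; apply: eq_bigr => w _.
rewrite raddf_sum mulr_sumr; apply: eq_bigr => w' _.
rewrite [LHS](free_evalU (g@_w * g'@_w') (mmul w w')) word_evalM.
by rewrite -pzscalerAl -pzscalerAr scalerA.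
Qed.
Fact free_eval_scalable : scalable free_eval.
Proof.
move=> c g; rewrite [LHS](free_evalEw (msuppZ_le c g)) scaler_sumr.
by apply: eq_bigr => w _; rewrite mcoeffZ scalerA.
Qed.
HB.instance Definition _ :=
  GRing.isMonoidMorphism.Build (free_alg R rho) V free_eval free_eval_monoid.
HB.instance Definition _ :=
  GRing.isScalable.Build R (free_alg R rho) V _ free_eval free_eval_scalable.

Definition free_evalm : {lrmorphism free_alg R rho -> V} := free_eval.

Lemma free_eval_var i : free_evalm (free_var R i) = y i.
Proof.
by rewrite /= /free_var free_evalU scale1r /word_eval fmU big_seq1.
Qed.

(** By linearity it suffices to treat words, which are built from 1 by
    multiplication on the left by variables.  This confines the image of an
    evaluation to a lattice that is an algebra. *)
Lemma free_eval_in (P : {pred V}) : 1 \in P ->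
  (forall i x, x \in P -> y i * x \in P) ->
  (forall x x', x \in P -> x' \in P -> x + x' \in P) ->
  (forall (c : R) x, x \in P -> c *: x \in P) ->
  forall g, free_evalm g \in P.
Proof.
move=> P1 Py PD PZ g; rewrite /= /free_eval.
have P0 : 0 \in P by rewrite -(scale0r (1 : V)) PZ.
elim/big_ind: _ => // w _; apply: PZ; rewrite /word_eval.
by elim: (w : seq _) => [|i s IH]; rewrite ?big_nil // big_cons Py.
Qed.

End Evaluation.

Lemma free_const_var (F : fieldType) rho (i : 'I_rho) :
  free_const (free_var F i) = free_var (fps F) i.
Proof.
rewrite /free_const /free_var msuppU oner_eq0 big_seq_fset1 mcoeffUU.
by rewrite rmorph1.
Qed.

(** * From lattices to flat deformations *)

Section Deformations.
Variables (F : fieldType) (N : pzAlgType F) (B : pzAlgType (fps F)).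
Hypothesis torsion_free : forall x : B, fps_t *: x = 0 -> x = 0.
Hypothesis separated :
  forall x : B, (forall k, exists z, x = fps_t ^+ k *: z) -> x = 0.
Notation pi := (\pi_(tquot B)).

Lemma lift_basis_along n (h : {rmorphism tquot B -> N}) (nu : 'I_n -> N) :
  scalable h -> bijective h -> is_basis nu ->
  exists2 b : 'I_n -> B, is_basis b & forall i, h (pi (b i)) = nu i.
Proof.
move=> hZ [g gK hK] /fin_basisP[ni ns]; pose b i := repr (g (nu i)).
have bE i : h (pi (b i)) = nu i by rewrite /b reprK hK.
have hL a : h (\sum_i a i *: pi (b i)) = \sum_i a i *: nu i.
  by rewrite rmorph_sum; apply: eq_bigr => i _; rewrite hZ bE.
exists b => //; apply: lift_basis => //; apply/fin_basisP; split=> [a a0|x].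
  by apply: ni; rewrite -hL a0 rmorph0.
by have [a xa] := ns (h x); exists a; apply: (can_inj gK); rewrite hL xa.
Qed.

(** The linear lift j0 of the basis is a section, but j0 1 need not be 1.  It is
    corrected by lambda(x) (1 - j0 1), which is zero modulo t, for a linear form
    lambda with lambda(1) = 1.  Such a form exists unless 1 = 0 in N, and then
    1 is divisible by all powers of t in B, whence B = 0. *)
Lemma unital_section n (h : {rmorphism tquot B -> N}) (nu : 'I_n -> N) (b : 'I_n -> B) :
  injective h -> scalable h -> is_basis nu -> (forall i, h (pi (b i)) = nu i) ->
  exists j : {additive N -> B},
    [/\ forall a x, j (a *: x) = fps_const a *: j x,
        forall x, h (pi (j x)) = x & j 1 = 1].
Proof.
move=> h_inj hZ /fin_basisP[ni ns] bE; have [c cE] := choice ns.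
have cL a : c (\sum_i a i *: nu i) =1 a.
  by move/fin_lin_indepP in ni; apply: (lin_indep_eq ni); rewrite -cE.
have cB x y i : c (x - y) i = c x i - c y i.
  rewrite -(cL (fun i => c x i - c y i)); congr (c _ i).
  under eq_bigr do rewrite scalerBl.
  by rewrite sumrB -!cE.
have cZ r x i : c (r *: x) i = r * c x i.
  rewrite -(cL (fun i => r * c x i)); congr (c _ i).
  by rewrite [in LHS](cE x) scaler_sumr; apply: eq_bigr => j _; rewrite scalerA.
pose j0 x := \sum_i fps_const (c x i) *: b i.
have hj0 x : h (pi (j0 x)) = x.
  rewrite /j0 pi_tquot_lincomb rmorph_sum [RHS]cE; apply: eq_bigr => i _.
  by rewrite hZ bE.
have j0B x y : j0 (x - y) = j0 x - j0 y.
  by rewrite /j0 -sumrB; apply: eq_bigr => i _; rewrite cB rmorphB scalerBl.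
have j0Z a x : j0 (a *: x) = fps_const a *: j0 x.
  by rewrite /j0 scaler_sumr; apply: eq_bigr => i _; rewrite cZ rmorphM scalerA.
have [lam [lamB lamZ lam1]] : exists lam : N -> F,
    [/\ forall x y, lam (x - y) = lam x - lam y,
        forall a x, lam (a *: x) = a * lam x
      & j0 1 + fps_const (lam 1) *: (1 - j0 1) = 1].
  have [[i ci]|c0] := pselect (exists i, c 1 i != 0).
    exists (fun x => c x i / c 1 i); split=> [x y|a x|].
    - by rewrite cB mulrBl.
    - by rewrite cZ mulrA.
    by rewrite divff // rmorph1 scale1r addrC subrK.
  exists (fun=> 0); split=> [x y|a x|]; rewrite ?subr0 ?mulr0 //.
  rewrite rmorph0 scale0r addr0.
  have c10 i : c 1 i = 0 by apply: contrapT => /eqP ci; apply: c0; exists i.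
  have N0 : 1 = 0 :> N by rewrite [LHS]cE big1 // => i _; rewrite c10 scale0r.
  have /pi_tquot_eq[z] : pi 1 = pi 0.
    by apply: h_inj; rewrite pi_tquot1 pi_tquot0 rmorph1 rmorph0.
  rewrite add0r => B1.
  have -> : 1 = 0 :> B.
    apply: separated => k; exists (z ^+ k); elim: k => [|k IH].
      by rewrite !expr0 scale1r.
    transitivity ((fps_t *: z) * (fps_t ^+ k *: z ^+ k)).
      by rewrite -B1 -IH mul1r.
    by rewrite -pzscalerAl -pzscalerAr scalerA -!exprS.
  by rewrite /j0 big1 // => i _; rewrite c10 rmorph0 scale0r.
pose j x := j0 x + fps_const (lam x) *: (1 - j0 1).
have jB : zmod_morphism j.
  move=> x y; rewrite /j j0B lamB rmorphB scalerBl opprD addrACA //.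
pose j1 := GRing.isZmodMorphism.Build N B j jB.
pose jj : {additive N -> B} := HB.pack j j1.
exists jj; split=> [a x|x|] /=; last exact: lam1.
  by rewrite /j j0Z lamZ rmorphM [RHS]scalerDr scalerA.
rewrite /j pi_tquotD pi_tquotZ0 rmorphD hZ hj0.
have -> : pi (1 - j0 1) = 0.
  apply: h_inj; rewrite pi_tquotD -[- j0 1]scaleN1r -(rmorphN1 (@fps_const F)).
  by rewrite pi_tquotZ scaleN1r rmorphB hj0 pi_tquot1 rmorph1 rmorph0 subrr.
by rewrite rmorph0 scaler0 addr0.
Qed.

Lemma deformation_of_quotient n (h : {rmorphism tquot B -> N}) (nu : 'I_n -> N) :
  scalable h -> bijective h -> is_basis nu -> is_deformation N B.
Proof.
move=> hZ hb nb; have [b bb bE] := lift_basis_along hZ hb nb; split.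
  by exists 'I_n, b.
exists h; split=> //; apply: unital_section nb bE => //; exact: bij_inj.
Qed.

End Deformations.

Section FlatLattice.
Variables (F : fieldType) (K : closedFieldType).
Variable iota : {rmorphism {fraction (fps F)} -> K}.
Notation psi := (series_to_closure iota).

Lemma series_to_closure_inj : injective psi.
Proof.
by move=> c d /fmorph_inj/eqP; rewrite tofrac_eq => /eqP.
Qed.

(** Here B is a subalgebra of t^(-m) A{t}, embedded by v.  The rank of B is n
    because B / tB is isomorphic to N, hence the matrix C of a basis of B is
    square, and it is invertible over K. *)
Lemma flat_of_lattice n (N A : pzAlgType F) (B : pzAlgType (fps F))
    (v : {rmorphism B -> laurent A}) m :
  has_dim N n -> has_dim A n -> scalable v -> injective v ->
  (forall x, bounded_by m (v x)) -> alg_isomorphic (tquot B) N ->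
  flat_deformation iota N A.
Proof.
move=> [nu nb] [a ab] vZ v_inj vm [h [hZ hb]].
have tf (x : B) : fps_t *: x = 0 -> x = 0.
  move=> tx; apply: v_inj; rewrite rmorph0; apply: (@lau_torsion_free _ _ 1).
  by rewrite expr1 -vZ tx rmorph0.
have sep (x : B) : (forall k, exists z, x = fps_t ^+ k *: z) -> x = 0.
  move=> xk; apply: v_inj; rewrite rmorph0; apply: (@lau_separated _ _ m) => k.
  by have [z ->] := xk k; exists (v z); rewrite ?vZ.
have [b bb bE] := lift_basis_along tf sep hZ hb nb.
exists B; split; first exact: deformation_of_quotient hZ hb nb.
have [beta [e bt]] := basis_mult_table bb.
have [alpha [eps a_table]] := basis_mult_table ab.
have span i : exists c : 'I_n -> fps F, v (b i) = \sum_j c j *: lau_basis a m j.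
  by rewrite -(lau_truncK (vm (b i))); apply: lau_basis_span.
have [C0 C0E] := choice span; pose C := \matrix_(i, j) C0 i j.
have vb : v \o b = mx_family C (lau_basis a m).
  apply/funext => i; rewrite /= C0E; apply: eq_bigr => j _.
  by rewrite mxE.
have vL (d : 'I_n -> fps F) : v (\sum_i d i *: b i) = \sum_i d i *: (v \o b) i.
  by rewrite rmorph_sum; apply: eq_bigr => i _; rewrite vZ.
have Ct : scaled_table_change alpha eps m C beta e.
  apply/(scaled_table_changeP ab a_table); rewrite -vb; case: bt => bM b1.
  by split=> [i j|]; rewrite -vL /= -?rmorphM ?bM -?b1 ?rmorph1.
have dC : \det C != 0.
  apply/(mx_family_indepE _ (@lau_basis_indep _ _ _ _ ab m)); rewrite -vb.
  case: bb => /fin_lin_indepP bi _; apply/fin_lin_indepP => d.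
  by rewrite -vL -(rmorph0 v) => /v_inj /bi.
have := Ct; rewrite (scaled_table_change_field _ _ _ _ _ _ series_to_closure_inj).
set M := _ *: _ => Mt.
have Mu : M \in unitmx.
  rewrite unitmxE detZ det_map_mx unitfE mulf_neq0 ?expf_neq0 ?invr_eq0 //.
    by rewrite -(rmorph0 psi) (inj_eq series_to_closure_inj) expf_neq0 ?fps_t_neq0.
  by rewrite -(rmorph0 psi) (inj_eq series_to_closure_inj).
have ea := ext_basis (const_to_closure iota) ab.
have et := ext_table (const_to_closure iota) a_table.
apply: alg_iso_of_table (ext_basis psi bb) (mx_family_basis Mu ea) (ext_table psi bt) _.
by apply/(table_changeP et) => //; case: ea.
Qed.

End FlatLattice.

(** * Laurent polynomial generators of a lattice *)

Section Generators.
Variables (F : fieldType) (n : nat) (A : pzAlgType F) (a : 'I_n -> A).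
Variables (alpha : 'I_n -> 'I_n -> 'I_n -> F) (eps : 'I_n -> F).
Hypotheses (ab : is_basis a) (a_table : mult_table a alpha eps).

Definition fps_take k (c : fps F) : fps F :=
  Fps (fun i => if (i < k)%N then fps_coef c i else 0).

Lemma fps_takeE k c : exists d, c = fps_take k c + fps_t ^+ k * d.
Proof.
exists (Fps (fun i => fps_coef c (k + i))); apply: fpsP => i.
rewrite fps_coefD fps_coef_tXM /=; case: ltnP => ki; rewrite ?addr0 //.
by rewrite add0r subnKC.
Qed.

(** Let det C = t^d u with u a unit.  The truncation of C at order d + 1 is
    C - t^(d+1) D = (1 - t D u^(-1) adj C) C, and the first factor is invertible
    because its determinant has constant term 1: this is Nakayama's lemma for
    the lattice spanned by the rows of C. *)
Lemma truncate_matrix (C : 'M[fps F]_n) : \det C != 0 ->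
  exists k P, P \in unitmx /\ P *m C = map_mx (fps_take k) C.
Proof.
move=> /fps_t_unit[d [u [uu dC]]]; exists d.+1.
have [D0 D0E] := choice (fun ij : 'I_n * 'I_n => fps_takeE d.+1 (C ij.1 ij.2)).
pose D := \matrix_(i, j) D0 (i, j).
have CE : map_mx (fps_take d.+1) C = C - fps_t ^+ d.+1 *: D.
  by apply/matrixP => i j; rewrite !mxE [in RHS](D0E (i, j)) addrK.
exists (1%:M - fps_t *: (D *m (u^-1 *: \adj C))); split.
  rewrite unitmxE fps_unitP -/(fps_coef0m _) -det_map_mx map_mxB map_mx1.
  rewrite map_mxZ /fps_coef0m /= scale0r subr0 det1.
  exact: oner_neq0.
rewrite mulmxBl mul1mx CE -scalemxAl -mulmxA -scalemxAl mul_adj_mx dC.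
rewrite scale_scalar_mx mulrCA (mulVr uu) mulr1 mul_mx_scalar scalerA.
by rewrite -exprS.
Qed.

(** The structure constants say that the span of the family t^(-m) C a is an
    algebra.  The truncations y_i span the same lattice, so the algebra they
    generate is this lattice. *)
Lemma lattice_generators m (C : 'M[fps F]_n) beta e :
  \det C != 0 -> scaled_table_change alpha eps m C beta e ->
  exists f : {lrmorphism free_alg (fps F) n -> laurent A},
  [/\ forall k, laurent_polynomial (f (free_var (fps F) k)),
      lin_indep (fun k => f (free_var (fps F) k)),
      forall y, exists p, f y = lau_shift m p
    & exists2 w : 'I_n -> image_alg f, is_basis w & mult_table w beta e].
Proof.
move=> dC Ct; have [k [P [Pu PC]]] := truncate_matrix dC.
pose L := lau_basis a m; pose phi := mx_family C L.
pose y := mx_family (map_mx (fps_take k) C) L.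
have yE i : y i = mx_family P phi i by rewrite mx_familyM PC.
have phi_table : mult_table phi beta e by apply/(scaled_table_changeP ab a_table).
have phi_indep : lin_indep phi.
  by case: (mx_family_indepE C (@lau_basis_indep _ _ _ _ ab m)) => _ /(_ dC).
pose f : {lrmorphism free_alg (fps F) n -> laurent A} := free_evalm y.
have fvar i : f (free_var (fps F) i) = y i by apply: free_eval_var.
have fZ c z : f (c *: z) = c *: f z by apply: free_eval_scalable.
pose span x := exists c : 'I_n -> fps F, x = \sum_i c i *: phi i.
have f_span z : span (f z).
  apply/asboolP; apply: (@free_eval_in _ _ _ y (fun x => `[< span x >])).
  - by apply/asboolP; case: phi_table => _ ->; exists e.
  - move=> i x /asboolP[c ->]; apply/asboolP; rewrite yE.
    by rewrite /mx_family (mult_table_prod _ _ phi_table); eexists.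
  - move=> x x' /asboolP[c ->] /asboolP[c' ->]; apply/asboolP.
    exists (fun i => c i + c' i); rewrite -big_split; apply: eq_bigr => i _.
    by rewrite scalerDl.
  - move=> d x /asboolP[c ->]; apply/asboolP; exists (fun i => d * c i).
    by rewrite scaler_sumr; apply: eq_bigr => i _; rewrite scalerA.
have phi_im i : phi i \in image_pred f.
  apply/asboolP; exists (\sum_j invmx P i j *: free_var (fps F) j).
  rewrite raddf_sum -[RHS]mx_family1 -(mulVmx Pu) -mx_familyM.
  by apply: eq_bigr => j _; rewrite [LHS]fZ fvar yE.
exists f; split=> [i|||].
- rewrite fvar /y /mx_family lau_basis_sum; exists k => l lk /=.
  case E: (l + m%:Z) => [j|] //; rewrite big1 // => j' _.
  have kj : (k <= j)%N by rewrite -lez_nat -E (le_trans (ltW lk)) // lerDl.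
  by rewrite mxE /= ltnNge kj scale0r.
- have y_indep : lin_indep y.
    have -> : y = mx_family P phi by apply/funext.
    apply/(mx_family_indepE _ phi_indep); apply: contraTneq Pu => dP.
    by rewrite unitmxE dP unitr0.
  by have -> : (fun k => f (free_var (fps F) k)) = y by apply/funext.
- move=> z; have [c ->] := f_span z.
  by rewrite lincomb_mx lau_basis_sum; eexists.
pose w i := ImageAlg (phi_im i).
have wL (c : 'I_n -> fps F) : val (\sum_i c i *: w i) = \sum_i c i *: phi i.
  by rewrite raddf_sum.
exists w.
  apply/fin_basisP; split=> [c c0|x].
    by move/fin_lin_indepP: phi_indep; apply; rewrite -wL c0.
  have /asboolP[z zx] := valP x; have [c cE] := f_span z.
  by exists c; apply: val_inj; rewrite wL -cE zx.
case: phi_table => phiM phi1; split=> [i j|]; apply: val_inj; rewrite wL.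
  by rewrite -phiM.
by rewrite -phi1.
Qed.

End Generators.

(** * From flat deformations to generators *)

(** Every nonzero series is a power of t times a unit, so powers of t suffice as
    denominators. *)
Lemma common_t_denominator (F : fieldType) (I : finType)
    (x : I -> {fraction (fps F)}) :
  exists m (c : I -> fps F), forall i,
    x i = (FracField.tofrac (fps_t ^+ m))^-1 * FracField.tofrac (c i).
Proof.
have [w [b [/fps_t_unit[m [u [uu wE]]] bE]]] := common_denominator x.
exists m, (fun i => u^-1 * b i) => i.
have t0 : FracField.tofrac (fps_t ^+ m : fps F) != 0.
  by rewrite tofrac_eq0 expf_neq0 ?fps_t_neq0.
have u0 : FracField.tofrac u != 0.
  by rewrite tofrac_eq0; apply: contraTneq uu => ->; rewrite unitr0.
have := bE i; rewrite wE !rmorphM rmorphV //= => <-.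
suff cancel (E : fieldType) (X T U : E) : T != 0 -> U != 0 ->
    X = T^-1 * (U^-1 * (X * (T * U))) by exact: cancel.
by move=> T0 U0; field; rewrite T0 U0.
Qed.

Section GeneratorsOfFlat.
Variables (F K : closedFieldType) (iota : {rmorphism {fraction (fps F)} -> K}).
Hypothesis char0 : [pchar F] =i pred0.
Hypothesis iota_closure : is_algebraic_closure iota.
Notation psi := (series_to_closure iota).
Notation tofrac := (@FracField.tofrac (fps F)).

(** The specialization is applied to the entries of M and of its inverse, so
    that the new matrix is again invertible. *)
Lemma table_change_specialize n (alpha beta : 'I_n -> 'I_n -> 'I_n -> fps F)
    (eps e : 'I_n -> fps F) (M : 'M[K]_n) :
  M \in unitmx ->
  table_change (fun i j k => psi (alpha i j k)) (fun k => psi (eps k)) M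
    (fun i j k => psi (beta i j k)) (fun k => psi (e k)) ->
  exists m (M1 : 'M[{fraction (fps F)}]_n), M1 \in unitmx /\
    table_change (fun i j k => tofrac (fps_subst m (alpha i j k)))
      (fun k => tofrac (fps_subst m (eps k))) M1
      (fun i j k => tofrac (fps_subst m (beta i j k)))
      (fun k => tofrac (fps_subst m (e k))).
Proof.
move=> Mu [MM M1].
pose x (i : bool * ('I_n * 'I_n)) := (if i.1 then M else invmx M) i.2.1 i.2.2.
have [m [Q [ev [ev' [evC ev'C evQ ker]]]]] :=
  puiseux_specialization char0 iota_closure x.
pose QM := \matrix_(i, j) Q (true, (i, j)).
pose QM' := \matrix_(i, j) Q (false, (i, j)).
have eq_ev p q : ev p = ev q -> ev' p = ev' q.
  by move=> pq; apply/eqP; rewrite -subr_eq0 -rmorphB ker // rmorphB pq subrr.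
have evM : map_mx ev QM = M by apply/matrixP => i j; rewrite !mxE evQ.
have evM' : map_mx ev QM' = invmx M by apply/matrixP => i j; rewrite !mxE evQ.
have evMij i j : ev (QM i j) = M i j by rewrite mxE evQ.
have evS c : ev (tofrac c)%:P = psi c by rewrite evC.
exists m, (map_mx ev' QM); split.
  have map_entry (S T : Type) (f : S -> T) (X : 'M[S]_n) i j :
    map_mx f X i j = f (X i j) by rewrite mxE.
  have QQ : map_mx ev (QM *m QM') = map_mx ev 1%:M.
    by rewrite map_mxM map_mx1 evM evM' mulmxV.
  have QQ' : map_mx ev' (QM *m QM') = map_mx ev' 1%:M.
    apply/matrixP => i j; move/matrixP: QQ => /(_ i j).
    by rewrite !map_entry; apply: eq_ev.
  rewrite map_mxM map_mx1 in QQ'.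
  have [evQ_unit _] := mulmx1_unit QQ'; exact: evQ_unit.
split=> [i j r|r].
  have -> : \sum_p \sum_q map_mx ev' QM i p * map_mx ev' QM j q *
        tofrac (fps_subst m (alpha p q r)) =
      ev' (\sum_p \sum_q QM i p * QM j q * (tofrac (alpha p q r))%:P).
    rewrite rmorph_sum; apply: eq_bigr => p _; rewrite rmorph_sum.
    by apply: eq_bigr => q _; rewrite !rmorphM ev'C !mxE.
  have -> : \sum_k tofrac (fps_subst m (beta i j k)) * map_mx ev' QM k r =
      ev' (\sum_k (tofrac (beta i j k))%:P * QM k r).
    by rewrite rmorph_sum; apply: eq_bigr => k _; rewrite rmorphM ev'C !mxE.
  apply: eq_ev; transitivity (\sum_k psi (beta i j k) * M k r).
    rewrite -MM rmorph_sum; apply: eq_bigr => p _; rewrite rmorph_sum.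
    by apply: eq_bigr => q _; rewrite !rmorphM evS !evMij.
  by rewrite rmorph_sum; apply: eq_bigr => k _; rewrite rmorphM evS evMij.
have -> : \sum_k tofrac (fps_subst m (e k)) * map_mx ev' QM k r =
    ev' (\sum_k (tofrac (e k))%:P * QM k r).
  by rewrite rmorph_sum; apply: eq_bigr => k _; rewrite rmorphM ev'C !mxE.
rewrite -ev'C; apply: eq_ev; rewrite evS -M1 rmorph_sum.
by apply: eq_bigr => k _; rewrite rmorphM evS evMij.
Qed.

(** The image of f is isomorphic to B with t replaced by a power of t, and has
    the same quotient by t as B. *)
Lemma generators_of_flat n (N A : pzAlgType F) :
  has_dim N n -> has_dim A n -> flat_deformation iota N A ->
  exists f : {lrmorphism free_alg (fps F) n -> laurent A},
  [/\ forall k, laurent_polynomial (f (free_var (fps F) k)),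
      lin_indep (fun k => f (free_var (fps F) k)),
      exists m, forall y, exists p, f y = lau_shift m p
    & alg_isomorphic (tquot (image_alg f)) N].
Proof.
move=> [nu nb] [a ab] [B [[[I [bI bIb]] [h [hZ hb _]]] [g [gZ gb]]]].
have [b bb bE] := lift_basis_along (free_torsion_free bIb)
  (free_separated bIb) hZ hb nb.
have [beta [e bt]] := basis_mult_table bb.
have [alpha [eps a_table]] := basis_mult_table ab.
have [ub ut] := alg_iso_table gZ gb (ext_basis psi bb) (ext_table psi bt).
have ea := ext_basis (const_to_closure iota) ab.
have et := ext_table (const_to_closure iota) a_table.
have [M Mu ME] := basis_mx ea ub.
have Mt : mult_table (mx_family M (tensor (const_to_closure iota) 1 \o a))
    (fun i j k => psi (beta i j k)) (fun k => psi (e k)).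
  by rewrite -(funext ME).
have [ei _] := ea.
have := (table_changeP et M _ _ ei).1 Mt.
move=> /(@table_change_specialize n (fun i j k => fps_const (alpha i j k)) beta
  (fun k => fps_const (eps k)) e M Mu)[s [M1 [M1u M1t]]].
have [m [c cE]] := common_t_denominator (fun ij : 'I_n * 'I_n => M1 ij.1 ij.2).
pose C := \matrix_(i, j) c (i, j).
have M1E : M1 = (tofrac (fps_t ^+ m))^-1 *: map_mx tofrac C.
  by apply/matrixP => i j; rewrite !mxE (cE (i, j)).
have dC : \det C != 0.
  apply: contraTneq M1u => dC.
  by rewrite M1E unitmxE detZ det_map_mx dC rmorph0 mulr0 unitr0.
have tofrac_inj : injective tofrac by move=> x y /eqP; rewrite tofrac_eq => /eqP.
have Ct : scaled_table_change alpha eps m C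
    (fun i j k => fps_subst s (beta i j k)) (fun k => fps_subst s (e k)).
  apply/(scaled_table_change_field alpha eps m C _ _ tofrac_inj).
  move: M1t; rewrite M1E; congr table_change.
    by do 3![apply/funext => ?]; rewrite fps_substC.
  by apply/funext => ?; rewrite fps_substC.
have [f [fl fi fm [w wb wt]]] := lattice_generators ab a_table dC Ct.
exists f; split=> //; first by exists m.
apply: (@alg_isomorphic_trans _ _ (tquot B)); last by exists h.
apply: alg_iso_of_table (tquot_basis wb) (tquot_basis bb) (tquot_table wt) _.
(* The substitution does not change the constant terms of the structure
   constants. *)
exact: tquot_table bt.
Qed.

Lemma flat_deformationP n (N A : pzAlgType F) : has_dim N n -> has_dim A n ->
  flat_deformation iota N A <->
  exists rho (f : {lrmorphism free_alg (fps F) rho -> laurent A}),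
    [/\ forall k, laurent_polynomial (f (free_var (fps F) k)),
        exists c : 'I_n -> free_alg F rho,
          lin_indep (fun k => f (free_const (c k))),
        exists m, forall y, exists p, f y = lau_shift m p
      & alg_isomorphic (tquot (image_alg f)) N].
Proof.
move=> dimN dimA; split=> [flat|[rho [f [_ _ [m fm] iso]]]].
  have [f [fl fi fm iso]] := generators_of_flat dimN dimA flat.
  exists n, f; split=> //; exists (fun k => free_var F k).
  rewrite (_ : (fun k => _) = (fun k => f (free_var (fps F) k))) //.
  by apply/funext => k; rewrite free_const_var.
(* The inclusion of the image is restated for the ring structure that comes
   with the algebra structure of [image_alg f]. *)
pose B : pzAlgType (fps F) := image_alg f.
pose v : B -> laurent A := @image_val _ _ _ f.
have vB : zmod_morphism v by [].
have vM : monoid_morphism v by [].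
pose v1 := GRing.isZmodMorphism.Build B (laurent A) v vB.
pose v2 := GRing.isMonoidMorphism.Build B (laurent A) v vM.
pose vm : {rmorphism B -> laurent A} := HB.pack v v1 v2.
have vZ : scalable vm by [].
have v_inj : injective vm by exact: val_inj.
have v_bounded x : bounded_by m (vm x).
  have /asboolP[y yx] : v x \in image_pred f := valP x.
  have [p fp] := fm y; rewrite /vm /= -yx fp; exact: lau_shift_boundedP.
exact: flat_of_lattice dimN dimA vZ v_inj v_bounded iso.
Qed.

End GeneratorsOfFlat.

Local Open Scope complex_scope.
Theorem theorem1 (R : realType)
    (K : closedFieldType) (iota : {rmorphism {fraction (fps R[i])} -> K})
    (K_closure : is_algebraic_closure iota)
    (n : nat) (N A : pzAlgType R[i])
    (dimN : has_dim N n) (dimA : has_dim A n) :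
  flat_deformation iota N A
  <->
  exists (rho : nat) (f : {lrmorphism free_alg (fps R[i]) rho -> laurent A}),
    [/\ forall k : 'I_rho, laurent_polynomial (f (free_var (fps R[i]) k)),
        exists c : 'I_n -> free_alg R[i] rho,
          lin_indep (fun k => f (free_const (c k))),
        exists gamma : nat, forall y : free_alg (fps R[i]) rho,
          exists p : fps A, f y = lau_shift gamma p
      & alg_isomorphic (tquot (image_alg f)) N].
Proof.
exact: (flat_deformationP (pchar_num R[i]) K_closure dimN dimA).
Qed.
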